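(* Let $f:X\to\mathbb{R}$ be a Lipschitz function, where $X=\{1,\dots,d\}^{\mathbb{N}}$, and for $\beta>0$ let $\mu_\beta$, $h_\beta$, $\nu_\beta$, $g_\beta$ be the equilibrium measure, main eigenfunction, eigenmeasure and normalized potential associated with $\beta f$. Suppose that for any cylinder $k\subset X$ the limit $\lim_{\beta\to+\infty}\frac1\beta\log(\mu_\beta(k))$ exists. Then, denoting $x=(x_1x_2x_3\dots)$: 1. The family of probabilities $(\mu_\beta)_{\beta>0}$ satisfies a large deviation principle with deviation function $I:X\to[0,+\infty]$, $$I(x):=-\lim_{n\to+\infty}\lim_{\beta\to+\infty}\frac1\beta\log(\mu_\beta([x_1\dots x_n])).$$ 2. There exists the uniform limit $R_+:=-\lim_{\beta\to+\infty}\frac{g_\beta}{\beta}$. It satisfies $$I=R_++I\circ\sigma\quad\text{and}\quad I\ge R_+^\infty.$$ 3. For every $x\in X$, $$I(x)=\inf_{y\in X_{max}(f)}\ \liminf_{n\to+\infty}\left(R_+^n(x_1\dots x_ny)+I(y)\right).$$ If $R_+^\infty(x)<+\infty$, there exists at least one point $y\in X_{max}(f)$ which is an accumulation point of $\{\sigma^nx\}_{n=1,2,\dots}$. For any such $y$, $$I(x)=R_+^\infty(x)+I(y).$$ 4. There exists the uniform limit $V=\lim_{\beta\to+\infty}\frac1\beta\log(h_\beta)$. 5. The eigenmeasures $\nu_\beta$ satisfy a large deviation principle with deviation function $I+V$.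
   Context: $X=\{1,\dots,d\}^{\mathbb{N}}$, $\mathbb{N}=\{1,2,3,\dots\}$, with the metric $d_\theta(x,y)=\theta^{\min\{i:\,x_i\ne y_i\}}$ for $x\neq y$, $\theta\in(0,1)$ fixed; $\sigma$ is the shift map on $X$. For $y=(y_1y_2\dots)\in X$, $(x_1\dots x_ny)$ denotes $(x_1x_2\dots x_ny_1y_2\dots)\in X$. A cylinder is a set $[x_1\dots x_n]=\{(x_1\dots x_ny): y\in X\}$. $C(X)$ denotes the continuous functions $X\to\mathbb R$ and $P(X)$ the (Borel) probabilities on $X$. For $\beta>0$ the Ruelle operator is $L_{\beta f}:C(X)\to C(X)$, $(L_{\beta f}w)(x)=\sum_{a\in\{1,\dots,d\}}e^{\beta f(ax)}w(ax)$. The pressure is $P(\beta f)=\sup_\mu\left(\int\beta f\,d\mu+h(\mu)\right)$ over $\sigma$-invariant $\mu\in P(X)$, where $h(\mu)$ is the Kolmogorov–Sinai entropy; the equilibrium measure $\mu_\beta$ of $\beta f$ is the (unique) $\sigma$-invariant probability attaining this supremum. The eigenmeasure $\nu_\beta\in P(X)$ satisfies $\int L_{\beta f}(u)\,d\nu_\beta=e^{P(\beta f)}\int u\,d\nu_\beta$ for all $u\in C(X)$. The main eigenfunction $h_\beta$ is the positive Lipschitz function with $L_{\beta f}(h_\beta)=e^{P(\beta f)}h_\beta$ and $\int h_\beta\,d\nu_\beta=1$. One has $d\mu_\beta=h_\beta\,d\nu_\beta$. Put $g_\beta:=\beta f+\log(h_\beta)-\log(h_\beta\circ\sigma)-P(\beta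 f)$. Large deviation principle (L.D.P.): a family of probabilities $(\eta_\beta)_{\beta>0}$ on $X$ satisfies a L.D.P. with deviation function $J$ if $J:X\to[0,+\infty]$ is lower semi-continuous and, for any cylinder $k\subset X$, $\lim_{\beta\to+\infty}\frac1\beta\log(\eta_\beta(k))=-\inf_{x\in k}J(x)$. Given the (real-valued, nonnegative) function $R_+$, set $R_+^n(x):=\sum_{j=0}^{n-1}R_+(\sigma^j(x))$ and $R_+^\infty(x):=\lim_{n\to+\infty}R_+^n(x)\in[0,+\infty]$. $m(f):=\sup\{\int f\,d\mu:\mu\in P(X)\ \sigma\text{-invariant}\}$; $M_{max}(f)$ is the set of $\sigma$-invariant $\mu\in P(X)$ with $\int f\,d\mu=m(f)$; $X_{max}(f):=\bigcup_{\mu\in M_{max}(f)}\operatorname{supp}(\mu)$. A point $y$ is an accumulation point of $\{\sigma^nx\}_{n=1,2,\dots}$ if there is an increasing sequence $n_i\to+\infty$ with $\sigma^{n_i}(x)\to y$. The value $+\infty$ is allowed for $I$, and equalities involving it are understood in $[0,+\infty]$ (e.g. $I(x)=R_+(x)+I(\sigma x)$ may read $+\infty=R_+(x)+\infty$). *)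

(* Defs.v *)
From HB Require Import structures.
From mathcomp Require Import all_boot all_order all_algebra.
From mathcomp Require Import all_classical all_reals all_analysis.

Set Implicit Arguments.
Unset Strict Implicit.
Unset Printing Implicit Defensive.

Import Order.TTheory GRing.Theory Num.Theory.
Import numFieldNormedType.Exports.

Local Open Scope classical_set_scope.
Local Open Scope ring_scope.

(* The space of one-sided sequences over an alphabet of d.+1 letters (the
   alphabet has to be nonempty); coordinates are numbered from 0, so that
   [x i] is the letter x_(i+1).  The proof [theta01] is a parameter of the type
   because the metric structure on it depends on theta. *)
Definition fullshift (R : realType) (theta : R) (theta01 : 0 < theta < 1)
  (d : nat) : Type := nat -> 'I_d.+1.

Section metric.
Context {R : realType} {theta : R} (theta01 : 0 < theta < 1) (d : nat).
Local Notation X := (fullshift theta01 d).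
Implicit Types x y z : X.

HB.instance Definition _ := Choice.copy X (nat -> 'I_d.+1).
HB.instance Definition _ := isPointed.Build X (fun=> ord0).

(* The exponent is shifted by one because coordinates are numbered from 0. *)
Definition seqdist x y : R :=
  if pselect (exists i, x i != y i) is left neq_xy
  then theta ^+ (ex_minn neq_xy).+1 else 0.

Let theta_ge0 : 0 <= theta. Proof. by case/andP: theta01 => /ltW. Qed.
Let theta_le1 : theta <= 1. Proof. by case/andP: theta01 => _ /ltW. Qed.

Let seqdist_ge0 x y : 0 <= seqdist x y.
Proof. by rewrite /seqdist; case: pselect => // ?; exact: exprn_ge0. Qed.

Let seqdist_lb x y i : x i != y i -> theta ^+ i.+1 <= seqdist x y.
Proof.
move=> xyi; rewrite /seqdist; case: pselect => [e|]; last by case; exists i.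
by case: ex_minnP => m _ /(_ _ xyi) mi; apply: ler_wiXn2l.
Qed.

Let seqdistxx x : seqdist x x = 0.
Proof.
rewrite /seqdist; case: pselect => // e; exfalso.
by case: e => i; rewrite eqxx.
Qed.

Let seqdist_positivity x y : seqdist x y = 0 -> x = y.
Proof.
move=> xy0; apply/funext => i; apply/eqP; apply: contraT => /seqdist_lb.
by rewrite xy0 leNgt exprn_gt0//; case/andP: theta01.
Qed.

Let seqdist_sym x y : seqdist x y = seqdist y x.
Proof.
rewrite /seqdist; case: pselect => [e1|n1]; case: pselect => [e2|n2] //.
- by congr (theta ^+ _.+1); apply: eq_ex_minn => i; rewrite eq_sym.
- by case: n2; case: e1 => i; exists i; rewrite eq_sym.
- by case: n1; case: e2 => i; exists i; rewrite eq_sym.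
Qed.

Let seqdist_triangle y x z : seqdist x z <= seqdist x y + seqdist y z.
Proof.
rewrite {1}/seqdist; case: pselect => [e|_]; last exact: addr_ge0.
case: ex_minnP => m xzm _.
have [xym|/seqdist_lb xym] := eqVneq (x m) (y m).
  rewrite xym in xzm.
  by apply: le_trans (seqdist_lb xzm) _; rewrite lerDr.
by apply: le_trans xym _; rewrite lerDl.
Qed.

HB.instance Definition _ := isMetric.Build R X
  seqdistxx seqdist_positivity seqdist_sym seqdist_triangle.

HB.instance Definition _ := Measurable.copy X (g_sigma_algebraType (@open X)).

End metric.

Section dynamics.
Context {R : realType} {theta : R} {theta01 : 0 < theta < 1} {d : nat}.
Local Notation X := (fullshift theta01 d).
Implicit Types (x y : X) (f phi u w h : X -> R) (mu nu : probability X R).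

Definition lipschitz_fun f :=
  exists C : R, forall x y, `|f x - f y| <= C * mdist x y.

Definition sshift x : X := fun i => x i.+1.

Definition prepend (a : 'I_d.+1) x : X := fun i => if i is j.+1 then x j else a.

(* The words x_1 ... x_n are represented by sequences extending them. *)
Definition concat x n y : X := fun i => if (i < n)%N then x i else y (i - n)%N.

Definition cylinder x n : set X := range (concat x n).

Definition is_cylinder (k : set X) := exists x n, k = cylinder x n.+1.

Definition ruelle phi w x : R :=
  \sum_(a < d.+1) expR (phi (prepend a x)) * w (prepend a x).

Definition shift_invariant mu :=
  forall A : set X, measurable A -> mu (sshift @^-1` A) = mu A.

(* A finite partition is given by the map xi sending a point to the index of
   its atom.  This is the Shannon entropy of the join of
   xi, xi o sshift, ..., xi o sshift^(n-1); recall that ln 0 = 0. *)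
Definition join_entropy mu (k : nat) (xi : X -> 'I_k) (n : nat) : R :=
  - \sum_(w : {ffun 'I_n -> 'I_k})
      let p := fine (mu [set x | forall j : 'I_n, xi (iter j sshift x) = w j]) in
      p * ln p.

Definition ks_entropy mu : \bar R := ereal_sup
  [set e | exists (k : nat) (xi : X -> 'I_k),
    (forall j, measurable (xi @^-1` [set j])) /\
    e = (limn (fun n => join_entropy mu xi n / n%:R))%:E].

Definition pressure phi : \bar R :=
  ereal_sup [set (\int[mu]_x (phi x)%:E + ks_entropy mu)%E | mu in shift_invariant].

(* Uniqueness is up to equality on Borel sets, since the value of a
   [probability] on a nonmeasurable set is arbitrary. *)
Definition equilibrium phi mu :=
  [/\ shift_invariant mu,
      (\int[mu]_x (phi x)%:E + ks_entropy mu)%E = pressure phi &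
      forall mu', shift_invariant mu' ->
        (\int[mu']_x (phi x)%:E + ks_entropy mu')%E = pressure phi ->
        forall A : set X, measurable A -> mu' A = mu A].

(* The pressure is an extended real, whence expeR; the eigenvalue equations
   force it to be finite. *)
Definition eigenmeasure phi nu := forall u, continuous u ->
  (\int[nu]_x (ruelle phi u x)%:E
   = expeR (pressure phi) * \int[nu]_x (u x)%:E)%E.

Definition eigenfunction phi nu h :=
  [/\ forall x, 0 < h x,
      lipschitz_fun h,
      forall x, ((ruelle phi h x)%:E = expeR (pressure phi) * (h x)%:E)%E &
      (\int[nu]_x (h x)%:E = 1)%E].

Definition normalized_potential phi h x : R :=
  phi x + ln (h x) - ln (h (sshift x)) - fine (pressure phi).

Definition log_rate (eta : R -> probability X R) (k : set X) (b : R) : \bar R :=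
  ((b^-1)%:E * lne (eta b k))%E.

Definition ldp (eta : R -> probability X R) (J : X -> \bar R) :=
  [/\ forall x, (0 <= J x)%E,
      lower_semicontinuous J &
      forall k, is_cylinder k ->
        log_rate eta k b @[b --> +oo%R] --> (- ereal_inf (J @` k))%E].

Definition deviation (eta : R -> probability X R) x : \bar R :=
  (- limn (fun n => lim (log_rate eta (cylinder x n) b @[b --> +oo%R])))%E.

Definition birkhoff f n x : R := \sum_(0 <= j < n) f (iter j sshift x).

Definition birkhoff_lim f x : \bar R := limn (fun n => (birkhoff f n x)%:E).

Definition max_integral f : \bar R :=
  ereal_sup [set (\int[mu]_x (f x)%:E)%E | mu in shift_invariant].

Definition maximizing f mu :=
  shift_invariant mu /\ (\int[mu]_x (f x)%:E)%E = max_integral f.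

Definition msupp mu : set X :=
  [set x | forall U : set X, open U -> U x -> (0 < mu U)%E].

Definition Xmax f : set X := \bigcup_(mu in maximizing f) msupp mu.

(* The orbit is indexed by n = 1, 2, ..., whence 0 < s 0. *)
Definition orbit_acc x y := exists s : nat -> nat,
  [/\ (0 < s 0)%N, {homo s : i j / (i < j)%N} &
      iter (s i) sshift x @[i --> \oo] --> y].

End dynamics.

(* Main.v *)
Require Import Defs.
From HB Require Import structures.
From mathcomp Require Import all_boot all_order all_algebra.
From mathcomp Require Import all_classical all_reals all_analysis.
From mathcomp Require Import measurable_realfun ring lra.

Set Implicit Arguments.
Unset Strict Implicit.
Unset Printing Implicit Defensive.

Import Order.TTheory GRing.Theory Num.Theory.
Import numFieldNormedType.Exports.

Local Open Scope classical_set_scope.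
Local Open Scope ring_scope.

(** For each [b] everything is read off cylinders. The eigenmeasure equation for
the indicator of a cylinder compares the masses of [[x_1 ... x_n]] and of its
shift, up to a factor controlled by the variation of [b * f]; and one
application of the Ruelle operator contracts the logarithmic variation of the
eigenfunction [h b], so that [ln (h b) / b] varies by at most [K * theta ^ n] on
cylinders of length [n], with [K] independent of [b]
([vary_ln_eigenfunction]). Hence the measure [h b * nu b] satisfies two-sided
Gibbs bounds. It is shift invariant, and the Gibbs bounds compute the entropy of
the partition into letters, so that it attains the pressure; uniqueness of the
equilibrium state identifies it with [mu b] ([equilibrium_eigenstate]). The
asymptotic part rests on two comparisons, uniform in [b]:
- the rates [- ln (mu b [x_1 ... x_n]) / b] and
  [- ln (mu b [x_2 ... x_n]) / b] differ by [- g b x / b], and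
- the rates of [nu b] and [mu b] on [[x_1 ... x_n]] differ by [ln (h b x) / b],
up to errors [O(theta ^ n)] ([rate_equilibriumS], [rate_eigenmeasure]).

The rate of a finite sum is the smallest of the rates, so a cylinder always has a
one-letter extension with the same limit rate. Following such extensions gives a
point at which the increasing limit [I] of the rates equals the rate of the
cylinder one started from; this is the large deviation principle
([rate_lim_branch], [ldp_rates]). The two comparisons above then express every
limit value of [- g b x / b] and of the rates of [nu b] through [I] and limits of
[ln (h b) / b]. Convergence is proved by following ultrafilters: everything in
sight is bounded, hence converges along an ultrafilter, and it suffices that the
limit does not depend on the ultrafilter. For [- g b / b] this is immediate. Two
limits [V] of [ln (h b) / b] solve the same cohomological equation
[Rp = p - f - V + V o sigma], hence differ by a constant, and the constant is
fixed by [inf (I + V) = 0], the large deviation principle for the probabilities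
[nu b] on the whole space ([eigenfunction_limit_le]). Pointwise convergence is
uniform because the variations are uniformly controlled ([vary_uniform_cvg]).

Finally, [I x = Rp^n x + I (sigma^n x)] for all [n]. If [Rp^oo x] is finite then
[Rp] tends to 0 along the orbit of [x], and an invariant probability carried by
the limit set of the orbit (Krylov and Bogolyubov, [krylov_bogolyubov]) integrates
[Rp] to 0, hence maximizes the integral of [f]: its support provides accumulation
points in [Xmax f] ([exists_maximizing_acc]). If [sigma^n x] is close to [y] then
[Rp^n] hardly distinguishes [x] from [x_1 ... x_n y]; together with the lower
semicontinuity of [I] this gives [I x = Rp^oo x + I y] for accumulation points
[y] ([deviation_acc]), and the formula for [I] follows
([deviation_formula]). *)

(** * Words and branches *)

Section words.
Context {R : realType} {theta : R} {theta01 : 0 < theta < 1} {d : nat}.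
Local Notation X := (fullshift theta01 d).
Implicit Types (x y z : X) (n m : nat) (w : seq 'I_d.+1) (u v : X -> R).

Lemma theta_gt0 : 0 < theta. Proof. by case/andP: theta01. Qed.
Lemma theta_lt1 : theta < 1. Proof. by case/andP: theta01. Qed.
Lemma theta_exp_gt0 n : 0 < theta ^+ n. Proof. exact/exprn_gt0/theta_gt0. Qed.

(** Equality of prefixes, rather than of all coordinates below [n], so that
agreement can be used for rewriting. *)
Definition agree n x y : Prop := mkseq x n = mkseq y n.

Lemma agreeP n x y : agree n x y <-> forall i, (i < n)%N -> x i = y i.
Proof.
split=> [e i ilt|e]; last first.
  by apply/eq_in_map => i; rewrite mem_iota => /andP[_]; exact: e.
by rewrite -(nth_mkseq (x 0%N) x ilt) e nth_mkseq.
Qed.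

Lemma agree_sym n x y : agree n x y -> agree n y x.
Proof. by rewrite /agree => ->. Qed.

Lemma agree_trans n y x z : agree n x y -> agree n y z -> agree n x z.
Proof. by rewrite /agree => -> ->. Qed.

Lemma agree_leq n m x y : (m <= n)%N -> agree n x y -> agree m x y.
Proof.
move=> mn /agreeP e; apply/agreeP => i im; apply: e; exact: leq_trans mn.
Qed.

Lemma agree0 x y : agree 0 x y. Proof. by []. Qed.

Lemma agreeSr n x y : agree n x y -> x n = y n -> agree n.+1 x y.
Proof.
move=> /agreeP e exy; apply/agreeP => i.
by rewrite ltnS leq_eqVlt => /orP[/eqP->|/e].
Qed.

Lemma mkseq_sshift x n : mkseq x n.+1 = x 0%N :: mkseq (sshift x) n.
Proof. by rewrite /mkseq -[n.+1]/(1 + n)%N iotaD map_cat /= (iotaDl 1) -map_comp. Qed.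

Lemma agree_sshift n x y : agree n.+1 x y -> agree n (sshift x) (sshift y).
Proof. by rewrite /agree !mkseq_sshift => -[]. Qed.

Lemma iter_sshiftE j x i : iter j sshift x i = x (i + j)%N.
Proof. by elim: j i => [|j IH] i; rewrite ?addn0 //= /sshift IH addSnnS. Qed.

Lemma agree_iter j n x y :
  agree (j + n) x y -> agree n (iter j sshift x) (iter j sshift y).
Proof.
move=> /agreeP e; apply/agreeP => i ilt.
by rewrite !iter_sshiftE e // addnC ltn_add2l.
Qed.

Lemma agree_concat n x y : agree n (concat x n y) x.
Proof. by apply/agreeP => i ilt; rewrite /concat ilt. Qed.

Lemma iter_concat n x y : iter n sshift (concat x n y) = y.
Proof.
apply/funext => i; rewrite iter_sshiftE /concat ltnNge leq_addl /=.
by rewrite addnK.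
Qed.

Lemma sshift_concatS n x y : sshift (concat x n.+1 y) = concat (sshift x) n y.
Proof. by apply/funext => i; rewrite /sshift /concat ltnS subSS. Qed.

Lemma agree_iter_concat j n x y m : (j <= n)%N -> agree m (iter n sshift x) y ->
  agree (n - j + m) (iter j sshift (concat x n y)) (iter j sshift x).
Proof.
move=> jn /agreeP e; apply: agree_iter; rewrite addnA subnKC //.
apply/agreeP => i ilt; rewrite /concat; case: ltnP => // ni.
by rewrite -e ?iter_sshiftE ?subnK // ltn_subLR.
Qed.

Lemma cylinderE x n : cylinder x n = [set y | agree n y x].
Proof.
apply/seteqP; split=> [_ [y _ <-]|y /agreeP e /=]; first exact: agree_concat.
exists (iter n sshift y) => //; apply/funext => i; rewrite /concat iter_sshiftE.
by case: ltnP => [/e//|ni]; rewrite subnK.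
Qed.

Lemma cylinder_refl x n : cylinder x n x. Proof. by rewrite cylinderE. Qed.

Lemma cylinder0 x : cylinder x 0 = setT.
Proof. by rewrite cylinderE; apply/seteqP; split. Qed.

Lemma eq_cylinder n x y : agree n x y -> cylinder x n = cylinder y n.
Proof. by rewrite !cylinderE => e; apply/seteqP; split=> z /=; rewrite /agree e. Qed.

Lemma cylinder_leq m n x : (m <= n)%N -> cylinder x n `<=` cylinder x m.
Proof. by move=> mn y; rewrite !cylinderE; exact: agree_leq. Qed.

Lemma sshift_prepend a x : sshift (prepend a x) = x. Proof. by []. Qed.

Lemma prepend_sshift x : prepend (x 0%N) (sshift x) = x.
Proof. by apply/funext => -[]. Qed.

Lemma agree_prepend a n x y :
  agree n x y -> agree n.+1 (prepend a x) (prepend a y).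
Proof. by rewrite /agree !mkseq_sshift /= => ->. Qed.

(** Only the first [n.+1] letters matter; the constant tail keeps one-letter
extensions in the type of points. *)
Definition extend x n (a : 'I_d.+1) : X := concat x n (fun=> a).

Lemma extendE x n a : extend x n a n = a.
Proof. by rewrite /extend /concat ltnn. Qed.

Lemma agree_extend x n a : agree n (extend x n a) x.
Proof. exact: agree_concat. Qed.

Lemma agree_extendS x n y : agree n y x -> agree n.+1 y (extend x n (y n)).
Proof.
move=> yx; apply: agreeSr; last by rewrite extendE.
by apply: agree_trans yx _; apply/agree_sym/agree_extend.
Qed.

Lemma cylinder_splitS x n :
  cylinder x n = \big[setU/set0]_(a < d.+1) cylinder (extend x n a) n.+1.
Proof.
apply/seteqP; split=> [y|y].
  rewrite cylinderE /= => yx; rewrite -bigcup_mkord_ord /=; exists (y n) => //=.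
  by rewrite inord_val cylinderE; exact: agree_extendS.
rewrite -bigcup_mkord_ord => -[a /= _]; rewrite !cylinderE /=.
move=> /(agree_leq (leqnSn n)) h; apply: agree_trans h _; exact: agree_extend.
Qed.

Lemma trivIset_extend x n :
  trivIset setT (fun a => cylinder (extend x n a) n.+1).
Proof.
apply/trivIsetP => a b _ _ ab; apply/seteqP; split=> // y.
rewrite !cylinderE /= => -[/agreeP/(_ n (leqnn _)) + /agreeP/(_ n (leqnn _))].
by rewrite !extendE => -> /eqP; rewrite (negbTE ab).
Qed.

(** This turns statements about cylinders into the existence of a point: a point
of least rate, a point charged by a measure, the point coded by a real number. *)
Lemma exists_branch (P : X -> nat -> Prop) x n :
  (forall y m, P y m -> exists a, P (extend y m a) m.+1) ->
  (forall y z m, agree m y z -> P y m -> P z m) ->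
  P x n -> exists2 y, agree n y x & forall m, (n <= m)%N -> P y m.
Proof.
move=> Pext Pag Px.
have step (s : {p : X * nat | P p.1 p.2}) : exists s' : {p : X * nat | P p.1 p.2},
    (sval s').2 = (sval s).2.+1 /\ agree (sval s).2 (sval s').1 (sval s).1.
  case: s => -[y m] /= Py; have [a Pa] := Pext _ _ Py.
  by exists (exist _ (extend y m a, m.+1) Pa); split=> //; exact: agree_extend.
have [nxt nxtP] := choice step.
pose s k := iter k nxt (exist _ (x, n) Px).
have s2 k : (sval (s k)).2 = (n + k)%N.
  by elim: k => [|k IH]; rewrite ?addn0 //= (nxtP _).1 IH addnS.
have sS k : agree (n + k) (sval (s k.+1)).1 (sval (s k)).1.
  by rewrite -s2; exact: (nxtP (s k)).2.
(* The nodes built after step k extend the node of step k. *)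
have sle k l : agree (n + k) (sval (s (k + l)%N)).1 (sval (s k)).1.
  elim: l => [|l IH]; first by rewrite addn0.
  rewrite addnS; apply: agree_trans IH.
  by apply: agree_leq (sS _); rewrite leq_add2l leq_addr.
pose y : X := fun i => (sval (s i.+1)).1 i.
have ys k : agree (n + k) y (sval (s k)).1.
  apply/agreeP => i ilt; rewrite /y.
  have /agreeP h1 := sle i.+1 k; have /agreeP h2 := sle k i.+1.
  by rewrite -h2 // addnC h1 // addnS ltnS leq_addl.
exists y; first by have := ys 0; rewrite addn0.
move=> m /subnKC <-; apply: Pag (agree_sym (ys _)) _.
by rewrite -s2; exact: svalP (s _).
Qed.

End words.

(** * Topology and Borel sets *)

Section topology.
Context {R : realType} {theta : R} {theta01 : 0 < theta < 1} {d : nat}.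
Local Notation X := (fullshift theta01 d).
Implicit Types (x y z : X) (n m : nat) (w : seq 'I_d.+1) (u v : X -> R).

Lemma mdist_lt_agree n x y : mdist x y < theta ^+ n -> agree n x y.
Proof.
move=> lt; apply/agreeP => i ilt; apply/eqP; apply: contraT => ne.
move: lt; rewrite ltNge => /negP[].
have th0 := theta_gt0 (theta01 := theta01).
have th1 := theta_lt1 (theta01 := theta01).
change (theta ^+ n <= seqdist x y); rewrite /seqdist.
case: pselect => [e|]; last by case; exists i.
case: ex_minnP => m _ /(_ _ ne) mi.
by apply: ler_wiXn2l; [exact: ltW|exact: ltW|exact: leq_ltn_trans ilt].
Qed.

Lemma agree_mdist_le n x y : agree n x y -> mdist x y <= theta ^+ n.+1.
Proof.
move=> /agreeP e.
have th0 := theta_gt0 (theta01 := theta01).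
have th1 := theta_lt1 (theta01 := theta01).
change (seqdist x y <= theta ^+ n.+1); rewrite /seqdist.
case: pselect => [ne|_]; last exact/ltW/theta_exp_gt0.
case: ex_minnP => m nem _; apply: ler_wiXn2l; [exact: ltW|exact: ltW|].
by rewrite ltnS leqNgt; apply: contra nem => /e ->.
Qed.

Lemma theta_exp_cvg0 : theta ^+ n @[n --> \oo] --> 0.
Proof.
have th0 := theta_gt0 (theta01 := theta01).
have : `|theta| < 1 by rewrite gtr0_norm // (theta_lt1 (theta01 := theta01)).
exact: cvg_expr.
Qed.

Lemma nbhs_cylinderP x (A : set X) : nbhs x A <-> exists n, cylinder x n `<=` A.
Proof.
split=> [/nbhs_ballP[e /= e0 eA]|[n nA]].
  have [n _ /(_ n (leqnn _)) /= ne] : \forall n \near \oo, theta ^+ n < e.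
    exact: (cvgr_lt _ theta_exp_cvg0).
  exists n => y; rewrite cylinderE => yx; apply: eA; rewrite ballEmdist /=.
  apply: le_lt_trans ne; apply: le_trans (agree_mdist_le (agree_sym yx)) _.
  by apply: ler_wiXn2l => //; apply/ltW; [exact: (theta_gt0 (theta01 := theta01))|exact: theta_lt1].
apply/nbhs_ballP; exists (theta ^+ n) => /=; first exact: theta_exp_gt0.
move=> y; rewrite ballEmdist /= => /mdist_lt_agree/agree_sym yx.
by apply: nA; rewrite cylinderE.
Qed.

Lemma nbhs_cylinder x n : nbhs x (cylinder x n).
Proof. by apply/nbhs_cylinderP; exists n. Qed.

Lemma open_cylinder x n : open (cylinder x n).
Proof.
rewrite openE => y; rewrite cylinderE => /= yx.
apply/nbhs_cylinderP; exists n => z; rewrite cylinderE /= => zy.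
exact: agree_trans zy yx.
Qed.

Lemma cvg_agreeP (T : Type) (F : set_system T) {FF : Filter F} (s : T -> X) y :
  s @ F --> y <-> forall n, \forall t \near F, agree n (s t) y.
Proof.
split=> [sy n|sy A /nbhs_cylinderP[n nA]].
  by have := sy _ (nbhs_cylinder y n); rewrite cylinderE.
by have := sy n; apply: filterS => t ty; apply: nA; rewrite cylinderE.
Qed.

(** An ultrafilter decides each letter, since there are finitely many; the
sequence of the letters that it selects is its limit. *)
Lemma compact_fullshift : compact [set: X].
Proof.
rewrite compact_ultra => F FU _.
have letter i : exists a, F [set x : X | x i = a].
  apply/not_existsP => nF.
  have : \forall x \near F, forall a, ~ (x i = a).
    apply: filter_forall => a.
    by have [/nF|] := in_ultra_setVsetC [set x : X | x i = a] FU.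
  by move=> /filter_ex[x /(_ (x i))].
have [y yP] := choice letter.
exists y; split=> //.
apply/(@cvg_agreeP _ F _ id) => n.
elim: n => [|n IH]; first by apply: nearW => x.
by near=> x; apply: agreeSr; near: x; [exact: IH|exact: yP].
Unshelve. all: by end_near. Qed.

(** Prefixes of length [n] form the finite type [{ffun 'I_n -> 'I_d.+1}], over
which one can sum and take finite intersections; the tail is arbitrary. *)
Definition ffunpt n (w : {ffun 'I_n -> 'I_d.+1}) : X :=
  fun i => if insub i is Some j then w j else ord0.

Lemma ffunptE n (w : {ffun 'I_n -> 'I_d.+1}) (j : 'I_n) : ffunpt w j = w j.
Proof. by rewrite /ffunpt valK. Qed.

Lemma agree_ffunpt n y : agree n y (ffunpt [ffun j : 'I_n => y j]).
Proof.
by apply/agreeP => i ilt; rewrite (ffunptE _ (Ordinal ilt)) ffunE.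
Qed.

(** Indexed by words, a countable type, cylinders give open sets as countable
unions. *)
Definition cyl w : set X := [set y | mkseq y (size w) = w].

Lemma cyl_mkseq x n : cyl (mkseq x n) = cylinder x n.
Proof. by rewrite cylinderE /cyl size_mkseq. Qed.

Definition wordpt w : X := fun i => nth ord0 w i.

Lemma mkseq_wordpt w : mkseq (wordpt w) (size w) = w.
Proof. exact: mkseq_nth. Qed.

Lemma cylE w : cyl w = cylinder (wordpt w) (size w).
Proof. by rewrite -cyl_mkseq mkseq_wordpt. Qed.

Lemma open_bigcup_cyl (U : set X) : open U ->
  U = \bigcup_(w in [set w | cyl w `<=` U]) cyl w.
Proof.
move=> oU; apply/seteqP; split=> [x Ux|x [w /= wU /wU]//].
have /nbhs_cylinderP[n nU] : nbhs x U by exact: open_nbhs_nbhs.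
by exists (mkseq x n); rewrite /= cyl_mkseq //; exact: cylinder_refl.
Qed.

Lemma open_measurable_fullshift (U : set X) : open U -> measurable U.
Proof. exact: sub_sigma_algebra. Qed.

Lemma measurable_cylinder x n : measurable (cylinder x n).
Proof. by apply: open_measurable_fullshift; exact: open_cylinder. Qed.

(** The empty set makes this a pi-system. *)
Definition cylinders : set (set X) := [set A | A = set0 \/ exists w, A = cyl w].

Lemma measurable_cylinders : @measurable _ X = <<s cylinders >>.
Proof.
apply/seteqP; split; last first.
  apply: smallest_sub; first exact: sigma_algebra_measurable.
  move=> _ [->|[w ->]]; first exact: measurable0.
  by rewrite cylE; exact: measurable_cylinder.
apply: smallest_sub; first exact: smallest_sigma_algebra.
move=> U /open_bigcup_cyl ->.
pose F w := if `[< cyl w `<=` U >] then cyl w else set0.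
have -> : \bigcup_(w in [set w | cyl w `<=` U]) cyl w = \bigcup_w F w.
  apply/seteqP; split=> [x [w /= wU wx]|x [w _]].
    by exists w => //; rewrite /F asboolT.
  by rewrite /F; case: asboolP => // wU wx; exists w.
have := @countable_bigcupT_measurable _ (g_sigma_algebraType cylinders) _ F.
apply; first exact: countableP.
move=> w; rewrite /F; case: asboolP => _; last exact: measurable0.
by apply: sub_sigma_algebra; right; exists w.
Qed.

Lemma setI_closed_cylinders : setI_closed cylinders.
Proof.
have sub w1 w2 : (size w1 <= size w2)%N -> cylinders (cyl w1 `&` cyl w2).
  move=> s12; have [[y [y1 y2]]|n12] := pselect (cyl w1 `&` cyl w2 !=set0).
    right; exists w2; apply/setIidPr => z z2.
    rewrite /cyl /=; rewrite -{2}y1; apply: agree_leq s12 _.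
    by rewrite /agree z2 y2.
  by left; apply/seteqP; split => // y y12; apply: n12; exists y.
move=> A B [->|[w1 ->]]; first by left; rewrite set0I.
move=> [->|[w2 ->]]; first by left; rewrite setI0.
by have [/sub//|/ltnW/sub] := leqP (size w1) (size w2); rewrite setIC.
Qed.

End topology.

(** * Means of continuous functions *)

Section integrals.
Context {R : realType} {theta : R} {theta01 : 0 < theta < 1} {d : nat}.
Local Notation X := (fullshift theta01 d).
Implicit Types (x y z : X) (n m : nat) (u v : X -> R) (rho : probability X R).

Lemma continuous_agreeP u : continuous u <->
  forall x (e : R), 0 < e -> exists n, forall y, agree n y x -> `|u x - u y| < e.
Proof.
split=> [cu x e e0|h x].
  have /nbhs_cylinderP[n nA] : nbhs x [set y | `|u x - u y| < e].
    by have /cvgrPdist_lt/(_ e e0) := cu x.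
  by exists n => y yx; apply: nA; rewrite cylinderE.
apply/(@cvgrPdist_lt _ _ _ _ (nbhs_filter (x : X))) => e /(h x)[n nA].
by apply/nbhs_cylinderP; exists n => y; rewrite cylinderE; exact: nA.
Qed.

Lemma sshift_continuous : continuous (@sshift R theta theta01 d).
Proof.
move=> x; apply/(@cvg_agreeP _ _ _ _ _ (nbhs x)) => n.
apply/nbhs_cylinderP; exists n.+1 => y.
by rewrite cylinderE; exact: agree_sshift.
Qed.

Lemma prepend_continuous a : continuous (@prepend R theta theta01 d a).
Proof.
move=> x; apply/(@cvg_agreeP _ _ _ _ _ (nbhs x)) => n.
apply/nbhs_cylinderP; exists n => y.
by rewrite cylinderE => /(agree_prepend a); exact: agree_leq.
Qed.

Lemma continuous_indic_cylinder x n :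
  continuous (\1_(cylinder x n) : X -> R).
Proof.
apply/continuous_agreeP => y e e0; exists n => z zy.
suff -> : \1_(cylinder x n) y = \1_(cylinder x n) z :> R by rewrite subrr normr0.
rewrite !indicE; congr (_ %:R : R); congr nat_of_bool.
apply/idP/idP; rewrite !inE cylinderE /=; first exact: agree_trans.
exact/agree_trans/agree_sym.
Qed.

Lemma prob_setT rho : rho setT = 1%E.
Proof. exact: probability_setT. Qed.

Lemma measurable_continuous u : continuous u -> measurable_fun setT u.
Proof.
move=> /continuousP cu; apply: (measurability _ (RGenOpens.measurableE _)).
move=> _ [_ [a [b ->] <-]]; rewrite setTI; apply: open_measurable_fullshift.
exact/cu/interval_open.
Qed.

Lemma measurable_sshift : measurable_fun setT (@sshift R theta theta01 d).
Proof.
apply: (@measurability _ _ _ _ _ _ (@open X)) => // _ [U oU <-].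
rewrite setTI; apply: open_measurable_fullshift.
by apply: open_comp => // x _; exact: sshift_continuous.
Qed.

HB.instance Definition _ := isMeasurableFun.Build _ _ X X
  (@sshift R theta theta01 d) measurable_sshift.

Lemma continuous_bounded u : continuous u -> exists M, forall x, `|u x| <= M.
Proof.
move=> cu; have /compact_bounded[M [_ Mu]] : compact (u @` setT).
  apply: continuous_compact; last exact: compact_fullshift.
  by apply: continuous_subspaceT.
exists (M + 1) => x; apply: (Mu (M + 1)); first by rewrite ltrDl.
by exists x.
Qed.

Lemma integrable_continuous rho u : continuous u ->
  rho.-integrable setT (EFin \o u).
Proof.
move=> cu; apply: measurable_bounded_integrable => //.
- by have := ltry (1 : R); rewrite -(prob_setT rho).
- exact: measurable_continuous.
- have [M uM] := continuous_bounded cu; exists M; split; first exact: num_real.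
  by move=> N MN x _; apply: le_trans (uM x) (ltW MN).
Qed.

Definition mean rho u : R := \int[rho]_x u x.

Lemma meanE rho u : continuous u -> (\int[rho]_x (u x)%:E)%E = (mean rho u)%:E.
Proof.
move=> cu; rewrite /mean /Rintegral fineK //.
by apply: integrable_fin_num => //; exact: integrable_continuous.
Qed.

Lemma eq_mean rho u v : u =1 v -> mean rho u = mean rho v.
Proof. by move=> uv; congr mean; apply/funext. Qed.

Lemma meanD rho u v : continuous u -> continuous v ->
  mean rho (fun x => u x + v x) = mean rho u + mean rho v.
Proof. by move=> cu cv; apply: RintegralD => //; exact: integrable_continuous. Qed.

Lemma meanB rho u v : continuous u -> continuous v ->
  mean rho (fun x => u x - v x) = mean rho u - mean rho v.
Proof. by move=> cu cv; apply: RintegralB => //; exact: integrable_continuous. Qed.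

Lemma meanZ rho c u : continuous u ->
  mean rho (fun x => c * u x) = c * mean rho u.
Proof. by move=> cu; apply: RintegralZl => //; exact: integrable_continuous. Qed.

Lemma mean_cst rho c : mean rho (fun=> c) = c.
Proof.
rewrite /mean Rintegral_cst // -[RHS]mulr1; congr (_ * _).
exact: (f_equal (@fine R) (prob_setT rho)).
Qed.

Lemma le_mean rho u v : continuous u -> continuous v ->
  (forall x, u x <= v x) -> mean rho u <= mean rho v.
Proof.
by move=> cu cv uv; apply: le_Rintegral => //; exact: integrable_continuous.
Qed.

Lemma continuous_sum (I : Type) (r : seq I) (u : I -> X -> R) :
  (forall i, continuous (u i)) -> continuous (fun x => \sum_(i <- r) u i x).
Proof.
move=> cu; elim: r => [|i r IH] x.
  by under eq_fun do rewrite big_nil; exact: cst_continuous.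
under eq_fun do rewrite big_cons.
by apply: (@cvgD _ _ _ _ (nbhs_filter (x : X))); [exact: (cu i x)|exact: IH].
Qed.

Lemma mean_sum rho (I : Type) (r : seq I) (u : I -> X -> R) :
  (forall i, continuous (u i)) ->
  mean rho (fun x => \sum_(i <- r) u i x) = \sum_(i <- r) mean rho (u i).
Proof.
move=> cu; elim: r => [|i r IH].
  by rewrite big_nil -[RHS](mean_cst rho 0); apply: eq_mean => x; rewrite big_nil.
rewrite big_cons -IH -meanD //; last exact: continuous_sum.
by apply: eq_mean => x; rewrite big_cons.
Qed.

Definition mass rho x n : R := fine (rho (cylinder x n)).

Lemma massE rho x n : rho (cylinder x n) = (mass rho x n)%:E.
Proof. by rewrite /mass fineK // fin_num_measure //; exact: measurable_cylinder. Qed.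

Lemma mean_indic rho x n : mean rho \1_(cylinder x n) = mass rho x n.
Proof.
by rewrite /mean /Rintegral integral_indic ?setIT //; exact: measurable_cylinder.
Qed.

Lemma mass_ge0 rho x n : 0 <= mass rho x n.
Proof. by rewrite fine_ge0. Qed.

Lemma mass_le1 rho x n : mass rho x n <= 1.
Proof.
rewrite -lee_fin -massE; apply: probability_le1; exact: measurable_cylinder.
Qed.

Lemma mass0 rho x : mass rho x 0 = 1.
Proof. by rewrite /mass cylinder0 prob_setT. Qed.

Lemma eq_mass rho x y n : agree n x y -> mass rho x n = mass rho y n.
Proof. by move=> xy; rewrite /mass (eq_cylinder xy). Qed.

Lemma mass_splitS rho x n :
  mass rho x n = \sum_(a < d.+1) mass rho (extend x n a) n.+1.
Proof.
apply: EFin_inj; rewrite -massE cylinder_splitS measure_bigsetU_ord //=.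
- by rewrite -sumEFin; apply: eq_bigr => a _; exact: massE.
- by move=> a; exact: measurable_cylinder.
- by apply: sub_trivIset (@trivIset_extend _ _ _ _ x n).
Qed.

Lemma mass_leq rho x m n : (m <= n)%N -> mass rho x n <= mass rho x m.
Proof.
move=> mn; rewrite -lee_fin -!massE; apply: le_measure; rewrite ?inE.
- exact: measurable_cylinder.
- exact: measurable_cylinder.
- exact: cylinder_leq.
Qed.

Lemma eq_on_cylinders rho (m : {measure set X -> \bar R}) :
  (forall x n, rho (cylinder x n) = m (cylinder x n)) ->
  forall A, measurable A -> rho A = m A.
Proof.
move=> e; apply: (measure_unique cylinders (fun=> setT)) => //.
- exact: measurable_cylinders.
- exact: setI_closed_cylinders.
- by move=> _; right; exists [::]; apply/seteqP; split.
- by rewrite bigcup_const //; exists 0%N.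
- by move=> _ [->|[w ->]]; [rewrite !measure0|rewrite cylE; exact: e].
- by move=> _; have := ltry (1 : R); rewrite -(prob_setT rho).
Qed.

Lemma shift_invariant_cylinders rho :
  (forall x n, rho (sshift @^-1` cylinder x n) = rho (cylinder x n)) ->
  shift_invariant rho.
Proof.
move=> e A mA.
pose m := distribution rho [the {mfun X >-> X} of @sshift R theta theta01 d].
apply/esym; apply: (@eq_on_cylinders rho m) mA => x n.
by rewrite -e.
Qed.

Lemma mean_sshift rho u : shift_invariant rho -> continuous u ->
  mean rho (u \o sshift) = mean rho u.
Proof.
move=> inv cu; rewrite /mean /Rintegral; congr fine.
have mu := (measurable_EFinP _ _).2 (measurable_continuous cu).
have cus : continuous (u \o sshift).
  by move=> x; apply: continuous_comp; [exact: sshift_continuous|exact: cu].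
have := integral_pushforward measurable_sshift mu (integrable_continuous rho cus) measurableT.
rewrite preimage_setT => <-.
by apply: eq_measure_integral => A mA _; exact: inv.
Qed.

End integrals.

(** * Variations on cylinders *)

Section log_exp.
Context {R : realType}.
Implicit Types a b t : R.

Lemma le_expRM_ln a b t : 0 < a -> 0 < b ->
  (a <= expR t * b) = (ln a <= t + ln b).
Proof. by move=> a0 b0; rewrite -[RHS]ler_expR expRD !lnK ?posrE. Qed.

Lemma ge_expRM_ln a b t : 0 < a -> 0 < b ->
  (expR t * b <= a) = (t + ln b <= ln a).
Proof. by move=> a0 b0; rewrite -[RHS]ler_expR expRD !lnK ?posrE. Qed.

End log_exp.

Section variations.
Context {R : realType} {theta : R} {theta01 : 0 < theta < 1} {d : nat}.
Local Notation X := (fullshift theta01 d).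
Implicit Types (x y z : X) (n m : nat) (u v : X -> R) (rho : probability X R).

Lemma continuous_add u v : continuous u -> continuous v ->
  continuous (fun x => u x + v x).
Proof.
move=> cu cv x; apply: (@cvgD _ _ _ _ (nbhs_filter (x : X))).
  exact: (cu x).
exact: (cv x).
Qed.

Lemma continuous_mul u v : continuous u -> continuous v ->
  continuous (fun x => u x * v x).
Proof.
move=> cu cv x; apply: (@cvgM _ _ _ (nbhs_filter (x : X))).
  exact: (cu x).
exact: (cv x).
Qed.

Lemma continuous_cst (c : R) : continuous (fun _ : X => c).
Proof. by move=> x; exact: cst_continuous. Qed.

Lemma continuous_opp u : continuous u -> continuous (fun x => - u x).
Proof.
move=> cu x; apply: (@cvgN _ _ _ _ (nbhs_filter (x : X))); exact: (cu x).
Qed.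

Lemma continuous_sub u v : continuous u -> continuous v ->
  continuous (fun x => u x - v x).
Proof. by move=> cu /continuous_opp; exact: continuous_add. Qed.

Lemma continuous_compR (F : R -> R) u : continuous u ->
  (forall x, {for u x, continuous F}) -> continuous (fun x => F (u x)).
Proof. by move=> cu cF x; apply: continuous_comp; [exact: (cu x)|exact: cF]. Qed.

Lemma continuous_exp u : continuous u -> continuous (fun x => expR (u x)).
Proof. by move=> cu; apply: continuous_compR => // x; exact: continuous_expR. Qed.

Lemma continuous_sshift u : continuous u -> continuous (fun x => u (sshift x)).
Proof.
by move=> cu x; apply: continuous_comp; [exact: sshift_continuous|exact: cu].
Qed.

Lemma continuous_prepend a u :
  continuous u -> continuous (fun x => u (prepend a x)).
Proof.
by move=> cu x; apply: continuous_comp; [exact: prepend_continuous|exact: cu].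
Qed.

(** The form in which Lipschitz bounds are used: variation [O(theta ^ n)] on
cylinders of length [n], with constants that are easy to follow. *)
Definition vary (C : R) u :=
  forall n x y, agree n x y -> `|u x - u y| <= C * theta ^+ n.

Lemma vary_dist C u : vary C u -> forall x y, `|u x - u y| <= C.
Proof. by move=> uC x y; have := uC 0%N x y (agree0 x y); rewrite expr0 mulr1. Qed.

Lemma vary_ge0 C u : vary C u -> 0 <= C.
Proof. by move=> /vary_dist/(_ point point); rewrite subrr normr0. Qed.

Lemma lipschitz_vary u : lipschitz_fun u -> exists C, vary C u.
Proof.
move=> [C uC]; exists `|C| => n x y /agree_mdist_le xy.
apply: le_trans (uC x y) _.
apply: (@le_trans _ _ (`|C| * mdist x y)).
  by rewrite ler_wpM2r ?mdist_ge0 // ler_norm.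
rewrite ler_wpM2l //; apply: le_trans xy _.
apply: ler_wiXn2l => //; apply/ltW; first exact: (theta_gt0 (theta01 := theta01)).
exact: (theta_lt1 (theta01 := theta01)).
Qed.

Lemma exists_exp_lt (C e : R) : 0 < e -> exists n, C * theta ^+ n < e.
Proof.
move=> e0.
have /cvgrPdist_lt/(_ e e0)[n _ /(_ n (leqnn _))] : C * theta ^+ n @[n --> \oo] --> 0.
  by rewrite -[X in _ --> X](mulr0 C); apply: cvgMr; exact: (theta_exp_cvg0 (theta01 := theta01)).
by rewrite /= sub0r normrN => /(le_lt_trans (ler_norm _)) ?; exists n.
Qed.

Lemma exp_theta_eq (c s t : R) : (forall n, `|s - t| <= c * theta ^+ n) -> s = t.
Proof.
move=> st; apply/eqP; rewrite -subr_eq0 -normr_le0; apply/ler_addgt0Pr => e e0.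
have [n /ltW ne] := exists_exp_lt c e0.
by rewrite add0r; exact: le_trans (st n) ne.
Qed.

Lemma vary_continuous C u : vary C u -> continuous u.
Proof.
move=> uC; apply/continuous_agreeP => x e /(exists_exp_lt C)[n ne].
by exists n => y /agree_sym xy; apply: le_lt_trans (uC n x y xy) ne.
Qed.

Lemma vary_scale C b u : 0 <= b -> vary C u -> vary (b * C) (fun x => b * u x).
Proof.
move=> b0 uC n x y xy; rewrite -mulrBr normrM ger0_norm // -mulrA ler_wpM2l //.
exact: uC.
Qed.

Lemma vary_add C D u v : vary C u -> vary D v -> vary (C + D) (fun x => u x + v x).
Proof.
move=> uC vD n x y xy; rewrite opprD addrACA mulrDl.
by apply: le_trans (ler_normD _ _) _; apply: lerD; [exact: uC|exact: vD].
Qed.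

Lemma vary_opp C u : vary C u -> vary C (fun x => - u x).
Proof. by move=> uC n x y xy; rewrite -opprD normrN; exact: uC. Qed.

Lemma vary_cst (c : R) : vary 0 (fun=> c).
Proof. by move=> n x y _; rewrite subrr normr0 mul0r. Qed.

Lemma vary_sshift C u : vary C u -> vary (C / theta) (fun x => u (sshift x)).
Proof.
have th0 := theta_gt0 (theta01 := theta01); move=> uC [|n] x y xy.
  rewrite expr0 mulr1; apply: le_trans (vary_dist uC _ _) _.
  rewrite ler_pdivlMr // ler_piMr ?(vary_ge0 uC) //; apply/ltW.
  exact: (theta_lt1 (theta01 := theta01)).
by rewrite exprS mulrA divfK ?gt_eqF //; apply: uC; exact: agree_sshift.
Qed.

Lemma mean_cylinder_ge rho u x n c : continuous u ->
  (forall y, agree n y x -> c <= u y) ->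
  c * mass rho x n <= mean rho (fun y => u y * \1_(cylinder x n) y).
Proof.
move=> cu uc; have ci := continuous_indic_cylinder (x := x) (n := n).
rewrite -mean_indic -meanZ //; apply: le_mean.
- by apply: continuous_mul => //; exact: continuous_cst.
- exact: continuous_mul.
move=> y; rewrite indicE; case: (boolP (y \in _)); rewrite ?mulr0 // inE.
by rewrite cylinderE !mulr1; exact: uc.
Qed.

Lemma mean_cylinder_le rho u x n c : continuous u ->
  (forall y, agree n y x -> u y <= c) ->
  mean rho (fun y => u y * \1_(cylinder x n) y) <= c * mass rho x n.
Proof.
move=> cu uc; have ci := continuous_indic_cylinder (x := x) (n := n).
rewrite -mean_indic -meanZ //; apply: le_mean.
- exact: continuous_mul.
- by apply: continuous_mul => //; exact: continuous_cst.
move=> y; rewrite indicE; case: (boolP (y \in _)); rewrite ?mulr0 // inE.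
by rewrite cylinderE !mulr1; exact: uc.
Qed.

End variations.

(** * Variation of the eigenfunction *)

Section eigendata.
Context {R : realType} {theta : R} {theta01 : 0 < theta < 1} {d : nat}.
Local Notation X := (fullshift theta01 d).
Implicit Types (x y z : X) (n m : nat) (u v : X -> R) (rho : probability X R).
Variables (phi : X -> R) (nu : probability X R) (h : X -> R) (A : R).
Hypothesis phiA : vary A phi.
Hypothesis nuE : eigenmeasure phi nu.
Hypothesis hE : eigenfunction phi nu h.

Local Notation P := (fine (pressure phi)).
Local Notation g := (normalized_potential phi h).

Let th0 : 0 < theta := theta_gt0 (theta01 := theta01).
Let th1 : theta < 1 := theta_lt1 (theta01 := theta01).
Let cphi : continuous phi := vary_continuous phiA.

Lemma eigenfunction_gt0 x : 0 < h x. Proof. by case: hE. Qed.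
Let h0 := eigenfunction_gt0.

Lemma ruelle_gt0 u x : (forall y, 0 < u y) -> 0 < ruelle phi u x.
Proof.
move=> u0; rewrite /ruelle big_ord_recl; apply: ltr_wpDr.
  by apply: sumr_ge0 => i _; rewrite mulr_ge0 ?expR_ge0 // ltW.
by rewrite mulr_gt0 ?expR_gt0.
Qed.

(** An infinite pressure would make the eigenvalue 0 or infinite, whereas the
eigenfunction and its image are positive and finite. *)
Lemma pressure_fin : pressure phi = P%:E.
Proof.
have [_ _ /(_ point) + _] := hE.
have r0 : 0 < ruelle phi h point by exact: ruelle_gt0.
case: (pressure phi) => [p//| |] /=.
  by rewrite mulyr gtr0_sg // mul1e.
by rewrite mul0e => -[e]; move: r0; rewrite e ltxx.
Qed.

Lemma ruelle_eigenfunction x : ruelle phi h x = expR P * h x.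
Proof. by case: hE => _ _ /(_ x) + _; rewrite pressure_fin /= => -[]. Qed.

Lemma continuous_ruelle u : continuous u -> continuous (ruelle phi u).
Proof.
move=> cu; apply: continuous_sum => a.
apply: continuous_mul; last exact: continuous_prepend.
by apply: continuous_exp; exact: continuous_prepend.
Qed.

Lemma mean_ruelle u : continuous u ->
  mean nu (ruelle phi u) = expR P * mean nu u.
Proof.
move=> cu; have := nuE cu; rewrite pressure_fin /= !meanE //.
  by rewrite -EFinM => -[].
exact: continuous_ruelle.
Qed.

Lemma continuous_eigenfunction : continuous h.
Proof. by case: hE => _ /lipschitz_vary[C /vary_continuous]. Qed.
Let ch := continuous_eigenfunction.

(** The eigenfunction is Lipschitz and bounded below by compactness; no control of
the constant in terms of the potential is available at this stage. *)
Lemma vary_ln_eigenfunction_ex : exists C, vary C (fun x => ln (h x)).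
Proof.
have [_ /lipschitz_vary[C hC] _ _] := hE.
have [M hM] : exists M, forall x, `|(h x)^-1| <= M.
  apply: continuous_bounded; apply: continuous_compR => // x.
  by apply: inv_continuous; rewrite gt_eqF.
exists (C * M) => n x y xy.
suff lem z t : agree n z t -> ln (h z) - ln (h t) <= C * M * theta ^+ n.
  by rewrite ler_norml lerNl opprB !lem //; exact: agree_sym.
move=> zt; rewrite -ln_div ?posrE //.
have -> : h z / h t = 1 + (h z - h t) / h t.
  by rewrite mulrBl divff ?gt_eqF // addrC subrK.
apply: le_trans (le_ln1Dx _) _.
  by rewrite mulrBl divff ?gt_eqF // ltrBrDl subrr divr_gt0.
apply: le_trans (ler_norm _) _; rewrite normrM mulrAC.
by apply: ler_pM => //; exact: hC.
Qed.

(** Inverse branches of the shift contract by [theta], so that applying the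
eigenvalue equation improves a bound [C] to [(A + C) * theta]. *)
Lemma vary_ln_eigenfunction_step C : vary C (fun x => ln (h x)) ->
  vary ((A + C) * theta) (fun x => ln (h x)).
Proof.
move=> hC n x y xy.
suff lem z t : agree n z t -> ln (h z) - ln (h t) <= (A + C) * theta * theta ^+ n.
  by rewrite ler_norml lerNl opprB !lem //; exact: agree_sym.
move=> zt; rewrite lerBlDr -le_expRM_ln //.
rewrite -(ler_pM2l (expR_gt0 P)) -ruelle_eigenfunction mulrCA.
rewrite -ruelle_eigenfunction /ruelle mulr_sumr; apply: ler_sum => a _.
have azt := agree_prepend a zt.
rewrite -[h (prepend a z)]lnK ?posrE // -[h (prepend a t)]lnK ?posrE //.
rewrite -!expRD ler_expR -mulrA -exprS.
have := ler_normlP _ _ (phiA azt); have := ler_normlP _ _ (hC _ _ _ azt).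
rewrite mulrDl; move=> [_ h1] [_ h2]; lra.
Qed.

(** This is the fixed point of [C |-> (A + C) * theta], approached by iterating the
previous lemma from an arbitrary initial bound. It scales with the potential,
which is what makes [ln h / b] equicontinuous in [b]. *)
Lemma vary_ln_eigenfunction :
  vary (A * (theta / (1 - theta))) (fun x => ln (h x)).
Proof.
have [C hC] := vary_ln_eigenfunction_ex.
set K := A * _; have KE : (A + K) * theta = K.
  by rewrite /K; field; rewrite subr_eq0 eq_sym lt_eqF.
have hk k : vary (K + theta ^+ k * (C - K)) (fun x => ln (h x)).
  elim: k => [|k /vary_ln_eigenfunction_step]; first by rewrite mul1r addrC subrK.
  by rewrite addrA mulrDl KE exprSr mulrAC.
move=> n x y xy; apply/ler_addgt0Pr => e e0.
have [k ke] := exists_exp_lt (theta01 := theta01) `|C - K| e0.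
apply: le_trans (hk k n x y xy) _; rewrite mulrDl lerD2l.
apply: le_trans (ltW ke); rewrite mulrC mulrA.
have tn : theta ^+ n <= 1 by apply: exprn_ile1; exact: ltW.
have tk := theta_exp_gt0 (theta01 := theta01) k.
have tn0 := theta_exp_gt0 (theta01 := theta01) n.
apply: (@le_trans _ _ (theta ^+ n * theta ^+ k * `|C - K|)).
  by rewrite ler_wpM2l ?ler_norm // mulr_ge0 // ltW.
by rewrite mulrC ler_wpM2l // ler_piMl // ltW.
Qed.

End eigendata.

(** * The invariant Gibbs measure *)

Section density.
Context {R : realType} {theta : R} {theta01 : 0 < theta < 1} {d : nat}.
Local Notation X := (fullshift theta01 d).
Variables (nu : probability X R) (h : X -> R).

(** The proofs are parameters so that the probability structure is inferred from
the term itself. *)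
Definition density_measure (ch : continuous h) (h_ge0 : forall x, 0 <= h x)
    (h1 : mean nu h = 1) (A : set X) : \bar R :=
  (\int[nu]_(x in A) (h x)%:E)%E.

Hypotheses (ch : continuous h) (h_ge0 : forall x, 0 <= h x).
Hypothesis h1 : mean nu h = 1.
Local Notation m := (density_measure ch h_ge0 h1).

Let m0 : m set0 = 0%E. Proof. by rewrite /m integral_set0. Qed.

Let m_ge0 A : (0 <= m A)%E.
Proof. by apply: integral_ge0 => x _; rewrite lee_fin. Qed.

Let m_sigma_additive : semi_sigma_additive m.
Proof.
move=> F mF tF mUF; rewrite /m ge0_integral_bigcup //.
- apply: is_cvg_ereal_nneg_natsum_cond => n _ _.
  by apply: integral_ge0 => x _; rewrite lee_fin.
- apply/measurable_EFinP; apply: measurable_funTS; exact: measurable_continuous.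
- by move=> x _; rewrite lee_fin.
Qed.

HB.instance Definition _ := isMeasure.Build _ _ _ m m0 m_ge0 m_sigma_additive.

Let m_setT : m setT = 1%E.
Proof. by rewrite /m meanE // h1. Qed.

HB.instance Definition _ := Measure_isProbability.Build _ _ _ m m_setT.

Lemma density_measureE A : measurable A ->
  m A = (\int[nu]_x (h x * \1_A x)%:E)%E.
Proof.
move=> mA; rewrite /m integral_mkcond; apply: eq_integral => x _.
by rewrite restrict_EFin patch_indic.
Qed.

End density.

Section gibbs.
Context {R : realType} {theta : R} {theta01 : 0 < theta < 1} {d : nat}.
Local Notation X := (fullshift theta01 d).
Implicit Types (x y z : X) (n m : nat) (u v : X -> R) (rho : probability X R).
Variables (phi : X -> R) (nu : probability X R) (h : X -> R) (A : R).
Hypothesis phiA : vary A phi.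
Hypothesis nuE : eigenmeasure phi nu.
Hypothesis hE : eigenfunction phi nu h.

Local Notation P := (fine (pressure phi)).
Local Notation g := (normalized_potential phi h).
Local Notation B := (A * (theta / (1 - theta))).

Let th0 : 0 < theta := theta_gt0 (theta01 := theta01).
Let th1 : theta < 1 := theta_lt1 (theta01 := theta01).
Let cphi : continuous phi := vary_continuous phiA.
Let ch : continuous h := continuous_eigenfunction hE.
Let h0 := eigenfunction_gt0 hE.
Let hB : vary B (fun x => ln (h x)) := vary_ln_eigenfunction phiA hE.
Let A0 : 0 <= A := vary_ge0 phiA.

(** The eigenmeasure equation for the indicator of a cylinder: the only preimage
of [y] that can lie in it is the one by the letter [x 0]. *)
Lemma mass_eigenmeasureS x n :
  expR P * mass nu x n.+1 =
  mean nu (fun y => expR (phi (prepend (x 0%N) y)) * \1_(cylinder (sshift x) n) y).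
Proof.
rewrite -mean_indic -(mean_ruelle phiA nuE hE); last exact: continuous_indic_cylinder.
apply: eq_mean => y; rewrite /ruelle (bigD1 (x 0%N)) //= [X in _ + X]big1 ?addr0.
  congr (_ * _); rewrite !indicE; congr (_ %:R); congr nat_of_bool.
  apply/idP/idP; rewrite !inE !cylinderE /=; first by move/agree_sshift.
  by move/(agree_prepend (x 0%N)); rewrite prepend_sshift.
move=> a ax; rewrite indicE memNset ?mulr0 // cylinderE /= => /agreeP/(_ 0%N isT).
by move=> /= e; move: ax; rewrite e eqxx.
Qed.

Let near_phi x n y : agree n y (sshift x) ->
  `|phi (prepend (x 0%N) y) - phi x| <= A * theta ^+ n.+1.
Proof.
by move=> /(agree_prepend (x 0%N)); rewrite prepend_sshift; exact: phiA.
Qed.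

Let cexp a : continuous (fun y => expR (phi (prepend a y))).
Proof. by apply: continuous_exp; exact: continuous_prepend. Qed.

Lemma mass_eigenmeasure_bounds x n :
  expR (phi x - A * theta ^+ n.+1) * mass nu (sshift x) n <= expR P * mass nu x n.+1
  <= expR (phi x + A * theta ^+ n.+1) * mass nu (sshift x) n.
Proof.
rewrite mass_eigenmeasureS; apply/andP; split.
  apply: mean_cylinder_ge => // y /near_phi; rewrite ler_expR ler_norml => /andP[+ _].
  by rewrite lerBrDl.
apply: mean_cylinder_le => // y /near_phi; rewrite ler_expR ler_norml => /andP[_].
by rewrite lerBlDl.
Qed.

Lemma mass_eigenmeasure_gt0 x n : 0 < mass nu x n.
Proof.
elim: n x => [|n IH] x; first by rewrite mass0.
have /andP[+ _] := mass_eigenmeasure_bounds x n.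
move=> /(lt_le_trans (mulr_gt0 (expR_gt0 _) (IH _))).
by rewrite pmulr_rgt0 ?expR_gt0.
Qed.
Let nu0 := mass_eigenmeasure_gt0.

Lemma ln_mass_eigenmeasureS x n :
  `|ln (mass nu x n.+1) - ln (mass nu (sshift x) n) - phi x + P|
  <= A * theta ^+ n.+1.
Proof.
have := mass_eigenmeasure_bounds x n.
have p0 : 0 < expR P * mass nu x n.+1 by rewrite mulr_gt0 ?expR_gt0.
move=> /andP[]; rewrite ge_expRM_ln // => h1; rewrite le_expRM_ln // => h2.
move: h1 h2; rewrite lnM ?posrE ?expR_gt0 // expRK => h1 h2.
rewrite ler_norml; apply/andP; split; lra.
Qed.

Let mean_h : mean nu h = 1.
Proof. by apply: EFin_inj; rewrite -meanE //; case: hE. Qed.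

Definition eigenstate : probability X R :=
  [the probability X R of density_measure ch (fun x => ltW (h0 x)) mean_h].
Local Notation rho := eigenstate.

Lemma mass_eigenstate x n :
  mass rho x n = mean nu (fun y => h y * \1_(cylinder x n) y).
Proof.
rewrite /mass /= density_measureE //; exact: measurable_cylinder.
Qed.

Lemma ln_mass_eigenstate_gt0 x n : 0 < mass rho x n /\
  `|ln (mass rho x n) - ln (mass nu x n) - ln (h x)| <= B * theta ^+ n.
Proof.
have hnear y : agree n y x ->
    expR (- (B * theta ^+ n) + ln (h x)) <= h y <= expR (B * theta ^+ n + ln (h x)).
  move=> /hB; rewrite -[h y in X in _ -> X]lnK ?posrE // !ler_expR ler_norml.
  by move=> /andP[h1 h2]; apply/andP; split; lra.
have lo : expR (- (B * theta ^+ n) + ln (h x)) * mass nu x n <= mass rho x n.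
  by rewrite mass_eigenstate; apply: mean_cylinder_ge => // y /hnear/andP[].
have hi : mass rho x n <= expR (B * theta ^+ n + ln (h x)) * mass nu x n.
  by rewrite mass_eigenstate; apply: mean_cylinder_le => // y /hnear/andP[].
have r0 : 0 < mass rho x n.
  by apply: lt_le_trans lo; rewrite mulr_gt0 ?expR_gt0.
split=> //; move: lo hi; rewrite le_expRM_ln // ge_expRM_ln // => h1 h2.
by rewrite ler_norml; apply/andP; split; lra.
Qed.

(** The eigenmeasure equation for [h * (1_k o sigma)] gives the mass of the
preimage of [k], because the Ruelle operator maps this function to
[1_k * ruelle phi h], a multiple of [1_k * h]. *)
Lemma eigenstate_invariant : shift_invariant rho.
Proof.
apply: shift_invariant_cylinders => x n.
have mc : measurable (cylinder x n) by exact: measurable_cylinder.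
have ms : measurable (sshift @^-1` cylinder x n).
  by rewrite -[X in measurable X]setTI; exact: measurable_sshift.
rewrite /= !density_measureE //.
have ci := continuous_indic_cylinder (x := x) (n := n).
have -> : (fun y => (h y * \1_(sshift @^-1` cylinder x n) y)%:E) =
          (fun y => (h y * \1_(cylinder x n) (sshift y))%:E).
  by apply/funext => y; rewrite !indicE; congr ((_ * _%:R)%:E); apply/idP/idP;
    rewrite !inE.
have cis : continuous (fun y => h y * \1_(cylinder x n) (sshift y)).
  by apply: continuous_mul => //; exact: continuous_sshift.
rewrite !meanE //; last exact: continuous_mul.
congr (_%:E); apply: (mulfI (lt0r_neq0 (expR_gt0 P))).
rewrite -(mean_ruelle phiA nuE hE) // -meanZ; last exact: continuous_mul.
apply: eq_mean => y; rewrite mulrA -(ruelle_eigenfunction hE) mulr_suml.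
by apply: eq_bigr => a _; rewrite mulrA.
Qed.

(** The coboundary [ln h - ln (h o sigma)] in the normalized potential accounts for
the density; what is left is the recursion for the eigenmeasure. *)
Lemma ln_mass_eigenstateS x n :
  `|ln (mass rho x n.+1) - ln (mass rho (sshift x) n) - g x|
  <= (A + 2 * B) * theta ^+ n.
Proof.
have := ln_mass_eigenmeasureS x n.
have [_ ] := ln_mass_eigenstate_gt0 x n.+1.
have [_ ] := ln_mass_eigenstate_gt0 (sshift x) n.
have tn : theta ^+ n.+1 <= theta ^+ n.
  by rewrite exprS ler_piMl ?ltW // exprn_gt0.
have B0 : 0 <= B by exact: vary_ge0 hB.
have At : A * theta ^+ n.+1 <= A * theta ^+ n by rewrite ler_wpM2l.
have Bt : B * theta ^+ n.+1 <= B * theta ^+ n by rewrite ler_wpM2l.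
rewrite !ler_norml /normalized_potential => /andP[? ?] /andP[? ?] /andP[? ?].
by apply/andP; split; lra.
Qed.

Lemma sum_normalized_potential x :
  \sum_(a < d.+1) expR (g (prepend a x)) = 1.
Proof.
have e : \sum_(a < d.+1) expR (g (prepend a x)) =
    ruelle phi h x * (expR (- (ln (h x) + P))).
  rewrite /ruelle mulr_suml; apply: eq_bigr => a _.
  rewrite -[h (prepend a x) in RHS]lnK ?posrE // -!expRD; congr expR.
  rewrite /normalized_potential sshift_prepend; lra.
rewrite e (ruelle_eigenfunction hE) -[h x in X in X * _]lnK ?posrE // -!expRD.
by rewrite -[RHS]expR0; congr expR; lra.
Qed.

Lemma normalized_potential_le0 x : g x <= 0.
Proof.
rewrite -expR_le1 -(sum_normalized_potential (sshift x)) (bigD1 (x 0%N)) //=.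
by rewrite prepend_sshift lerDl; apply: sumr_ge0 => a _; exact: expR_ge0.
Qed.

Lemma vary_normalized_potential : vary (A + B + B / theta) g.
Proof.
have h1 := vary_add (vary_add phiA hB) (vary_opp (vary_sshift hB)).
by have := vary_add h1 (vary_cst (- P)); rewrite addr0.
Qed.

End gibbs.

(** * Entropy and the equilibrium measure *)

Section entropy.
Context {R : realType} {theta : R} {theta01 : 0 < theta < 1} {d : nat}.
Local Notation X := (fullshift theta01 d).
Implicit Types (x y z : X) (n m : nat) (u v : X -> R).
Variables (rho : probability X R) (g : X -> R) (D : R).
Hypothesis rho_inv : shift_invariant rho.
Hypothesis cg : continuous g.
Hypothesis mD : forall x n,
  `|ln (mass rho x n.+1) - ln (mass rho (sshift x) n) - g x| <= D * theta ^+ n.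

Let th0 : 0 < theta := theta_gt0 (theta01 := theta01).
Let th1 : theta < 1 := theta_lt1 (theta01 := theta01).
Local Notation Q := (D / (1 - theta)).

Let D0 : 0 <= D.
Proof.
have := mD point 0; rewrite expr0 mulr1; exact: le_trans.
Qed.

Lemma birkhoffS u n x : birkhoff u n.+1 x = u x + birkhoff u n (sshift x).
Proof.
rewrite /birkhoff big_nat_recl //=; congr (_ + _).
by apply: eq_bigr => j _; rewrite -iterS iterSr.
Qed.

Lemma continuous_birkhoff u n : continuous u -> continuous (birkhoff u n).
Proof.
move=> cu; apply: continuous_sum => j.
elim: j u cu => [//|j IH] u cu; exact: (IH _ (continuous_sshift cu)).
Qed.

Lemma mean_birkhoff u n : continuous u -> mean rho (birkhoff u n) = n%:R * mean rho u.
Proof.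
move=> cu; elim: n => [|n IH].
  by rewrite mul0r -[RHS](mean_cst rho 0); apply: eq_mean => x; rewrite /birkhoff big_nil.
rewrite (@eq_mean _ _ _ _ rho _ (fun x => u x + birkhoff u n (sshift x))); last first.
  by move=> x; exact: birkhoffS.
have cb := continuous_birkhoff (n := n) cu.
rewrite meanD //; last exact: continuous_sshift.
by rewrite (mean_sshift rho_inv cb) IH -natr1 mulrDl mul1r addrC.
Qed.

(** The errors of the successive comparisons form a geometric series, so that the
bound does not depend on [n]. *)
Lemma gibbs_bound x n : `|ln (mass rho x n) - birkhoff g n x| <= Q.
Proof.
suff : `|ln (mass rho x n) - birkhoff g n x| <= Q * (1 - theta ^+ n).
  move=> /le_trans; apply; rewrite ler_piMr //.
    by rewrite divr_ge0 // subr_ge0 ltW.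
  by rewrite gerBl exprn_ge0 // ltW.
elim: n x => [|n IH] x.
  by rewrite mass0 ln1 /birkhoff big_nil subrr normr0 expr0 subrr mulr0.
have := mD x n; have := IH (sshift x); rewrite birkhoffS.
have -> : Q * (1 - theta ^+ n.+1) = Q * (1 - theta ^+ n) + D * theta ^+ n.
  by rewrite exprS; field; rewrite subr_eq0 eq_sym lt_eqF.
rewrite !ler_norml => /andP[? ?] /andP[? ?].
by apply/andP; split; lra.
Qed.

Let cylinder_word n (w : {ffun 'I_n -> 'I_d.+1}) :
  cylinder (ffunpt w) n = [set x : X | forall j : 'I_n, x j = w j].
Proof.
rewrite cylinderE; apply/seteqP; split=> x /=.
  by move=> /agreeP e j; rewrite e // ffunptE.
by move=> e; apply/agreeP => i ilt; rewrite (e (Ordinal ilt)) -(@ffunptE _ _ theta01).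
Qed.

Let sum_indic n x :
  \sum_(w : {ffun 'I_n -> 'I_d.+1}) \1_(cylinder (ffunpt w) n) x = 1 :> R.
Proof.
rewrite (bigD1 [ffun j : 'I_n => x j]) //= big1 ?addr0.
  by rewrite indicE mem_set // cylinder_word /= => j; rewrite ffunE.
move=> w wx; rewrite indicE memNset // cylinder_word /= => e.
by move/eqP: wx; apply; apply/ffunP => j; rewrite ffunE e.
Qed.

Let mean_split n u : continuous u -> mean rho u =
  \sum_(w : {ffun 'I_n -> 'I_d.+1}) mean rho (fun x => u x * \1_(cylinder (ffunpt w) n) x).
Proof.
move=> cu; rewrite -mean_sum.
  by apply: eq_mean => x; rewrite -mulr_sumr sum_indic mulr1.
move=> w; apply: continuous_mul => //; exact: continuous_indic_cylinder.
Qed.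

Let sum_mass n : \sum_(w : {ffun 'I_n -> 'I_d.+1}) mass rho (ffunpt w) n = 1.
Proof.
rewrite -(mean_cst rho 1) (mean_split n); last exact: continuous_cst.
by apply: eq_bigr => w _; rewrite -mean_indic; apply: eq_mean => x; rewrite mul1r.
Qed.

(** On each cylinder [- ln] of the mass is a Birkhoff sum of [- g] up to [Q], and by
invariance the mean of the Birkhoff sum is [n] times the mean of [g]. *)
Lemma join_entropy_bound n :
  `|join_entropy rho (fun x => x 0%N) n + n%:R * mean rho g| <= Q.
Proof.
rewrite -mean_birkhoff // (mean_split n); last exact: continuous_birkhoff.
rewrite /join_entropy addrC -sumrB; apply: le_trans (ler_norm_sum _ _ _) _.
rewrite -[leRHS]mulr1 -[X in _ <= _ * X](sum_mass n) mulr_sumr; apply: ler_sum => w _.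
have -> : [set x : X | forall j : 'I_n, iter j sshift x 0%N = w j] =
    cylinder (ffunpt w) n.
  by rewrite cylinder_word; apply/seteqP; split=> x /= e j; have := e j;
    rewrite iter_sshiftE.
rewrite -/(mass rho (ffunpt w) n) /=.
have near y : agree n y (ffunpt w) ->
    - Q + ln (mass rho (ffunpt w) n) <= birkhoff g n y <= Q + ln (mass rho (ffunpt w) n).
  move=> yw; have := gibbs_bound y n; rewrite (eq_mass _ yw) ler_norml.
  by move=> /andP[? ?]; apply/andP; split; lra.
have cb := continuous_birkhoff (n := n) cg.
have lo := mean_cylinder_ge rho cb (fun y yw => (andP (near y yw)).1).
have hi := mean_cylinder_le rho cb (fun y yw => (andP (near y yw)).2).
by rewrite ler_norml; apply/andP; split; move: lo hi; lra.
Qed.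

(** The pressure is a supremum, so that a lower bound on the entropy attains it, and
the partition into letters provides one. The two-sided bound of
[join_entropy_bound] shows that the limit defining its entropy exists. *)
Lemma ks_entropy_ge : ((- mean rho g)%:E <= ks_entropy rho)%E.
Proof.
apply: ereal_sup_ubound; exists d.+1, (fun x => x 0%N); split.
  move=> j; have -> : (fun x : X => x 0%N) @^-1` [set j] = cylinder (fun=> j) 1.
    rewrite cylinderE; apply/seteqP; split=> x /=.
      by move=> x0; apply/agreeP => -[].
    by move=> /agreeP/(_ 0%N isT).
  exact: measurable_cylinder.
congr (_%:E); apply/esym/cvg_lim => //.
apply/cvgrPdist_lt => e e0.
near=> n.
have n0 : (0 < n)%N by near: n; exact: nbhs_infty_gt.
have nr0 : 0 < n%:R :> R by rewrite ltr0n.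
rewrite -opprD normrN -(ltr_pM2r nr0) -[X in _ * X]ger0_norm ?ltW // -normrM.
rewrite mulrDl divfK ?gt_eqF // addrC [_ * n%:R]mulrC.
apply: le_lt_trans (join_entropy_bound n) _.
rewrite -ltr_pdivrMl // mulrC; near: n.
exact: nbhs_infty_gtr.
Unshelve. all: by end_near. Qed.

End entropy.

Section equilibrium_gibbs.
Context {R : realType} {theta : R} {theta01 : 0 < theta < 1} {d : nat}.
Local Notation X := (fullshift theta01 d).
Implicit Types (x y z : X) (n m : nat) (u v : X -> R) (rho : probability X R).
Variables (phi : X -> R) (mu nu : probability X R) (h : X -> R) (A : R).
Hypothesis phiA : vary A phi.
Hypothesis muE : equilibrium phi mu.
Hypothesis nuE : eigenmeasure phi nu.
Hypothesis hE : eigenfunction phi nu h.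
Local Notation P := (fine (pressure phi)).
Local Notation g := (normalized_potential phi h).
Local Notation B := (A * (theta / (1 - theta))).
Local Notation rho := (eigenstate hE).

(** The probability [h nu] attains the pressure, so that uniqueness identifies it
with the equilibrium measure. *)
Lemma equilibrium_eigenstate x n : mass mu x n = mass rho x n.
Proof.
have [_ _ uniq] := muE.
have rho_inv : shift_invariant rho by exact: (eigenstate_invariant phiA nuE hE).
have ch := continuous_eigenfunction hE.
have cphi := vary_continuous phiA.
have cg : continuous g.
  exact: vary_continuous (vary_normalized_potential phiA hE).
have clnh : continuous (fun x => ln (h x)).
  exact: vary_continuous (vary_ln_eigenfunction phiA hE).
(* The coboundary ln h - ln h o sigma has mean zero. *)
have mean_g : mean rho g = mean rho phi - P.
  rewrite /normalized_potential meanB; last exact: continuous_cst.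
    rewrite mean_cst; congr (_ - _).
    rewrite meanB; last exact: (continuous_sshift clnh).
      rewrite meanD // (mean_sshift rho_inv clnh) addrK //.
    exact: continuous_add.
  apply: continuous_sub; first exact: continuous_add.
  exact: (continuous_sshift clnh).
suff e : (\int[rho]_x (phi x)%:E + ks_entropy rho)%E = pressure phi.
  rewrite /mass -(uniq rho rho_inv e) //; exact: measurable_cylinder.
apply/eqP; rewrite eq_le; apply/andP; split.
  by apply: ereal_sup_ubound; exists rho.
rewrite (pressure_fin hE) meanE //.
have := ks_entropy_ge rho_inv cg (ln_mass_eigenstateS phiA nuE hE).
rewrite mean_g opprB => /(leeD2l (mean rho phi)%:E); apply: le_trans.
by rewrite -EFinD lee_fin addrC subrK.
Qed.

End equilibrium_gibbs.

(** * Limits along ultrafilters *)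

Section ultrafilters.
Context {T : Type} {R : realType}.
Implicit Types (F G : set_system T).

(** Convergence can be tested on ultrafilters: a neighbourhood of the limit
missed on a set meeting every member of [F] is missed along an ultrafilter. *)
Lemma cvg_ultra (V : topologicalType) F (FF : Filter F) (u : T -> V) (l : V) :
  (forall G, UltraFilter G -> F `<=` G -> u @ G --> l) -> u @ F --> l.
Proof.
move=> uG A lA; apply: contrapT => nFA.
(* The traces of F on the set where u avoids A. *)
pose F' := filter_from F (fun B => B `&` ~` (u @^-1` A)).
have FF' : ProperFilter F'.
  apply: filter_from_proper.
    apply: filter_from_filter; first by exists setT; exact: filterT.
    move=> B C FB FC; exists (B `&` C); first exact: filterI.
    by move=> x [[Bx Cx] nA].
  move=> B FB; apply: contrapT => nB; apply: nFA.
  suff : F (u @^-1` A) by [].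
  apply: filterS FB => x Bx; apply: contrapT => nAx.
  by apply: nB; exists x; split.
have [G [GU FG]] := ultraFilterLemma FF'.
have : G (u @^-1` A).
  apply: (uG G GU) lA; apply: subset_trans FG => B FB.
  by exists B => // x [].
have : G (~` (u @^-1` A)).
  by apply: FG; exists setT; [exact: filterT|move=> x []].
move=> G1 G2; have [x []//] := filter_ex (filterI G1 G2).
Qed.

Lemma ultra_fmap (V : Type) G (u : T -> V) : UltraFilter G -> UltraFilter (u @ G).
Proof.
move=> GU; split; first exact: fmap_proper_filter.
move=> H HP GH; apply/seteqP; split=> // A HA.
have [//|nGA] := in_ultra_setVsetC (u @^-1` A) GU.
have : H (~` A) by exact: GH.
by move=> HnA; have [x []//] := filter_ex (filterI HA HnA).
Qed.

Lemma bounded_ultra_cvg G (GU : UltraFilter G) (u : T -> R) M :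
  (\forall t \near G, `|u t| <= M) -> exists l : R, u @ G --> l.
Proof.
move=> uM; have GU' : UltraFilter (u @ G) by exact: ultra_fmap.
have := @segment_compact R (- M) M; rewrite compact_ultra => /(_ _ GU').
case=> [|l [_ ul]]; last by exists l.
by apply: filterS uM => t; rewrite /= in_itv /= -ler_norml.
Qed.

End ultrafilters.

(** * Exponential rates and large deviations *)

Section suprema.
Context {R : realType}.
Implicit Types (a b : R^nat).

(** The rates are real and increase with the length of the cylinder, but their limit
may be infinite. *)
Definition esup_seq a : \bar R := ereal_sup (range (EFin \o a)).

Lemma esup_seq_ub a n : ((a n)%:E <= esup_seq a)%E.
Proof. by apply: ereal_sup_ubound; exists n. Qed.

Lemma esup_seq_le a (M : \bar R) :
  (forall n, (a n)%:E <= M)%E -> (esup_seq a <= M)%E.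
Proof. by move=> aM; apply: ge_ereal_sup => _ [n _ <-]; exact: aM. Qed.

Lemma cvg_esup_seq a : nondecreasing_seq a -> (a n)%:E @[n --> \oo] --> esup_seq a.
Proof.
move=> nda; apply: ereal_nondecreasing_cvgn => n m nm.
by rewrite lee_fin; exact: nda.
Qed.

(** As [a] is nondecreasing, errors that vanish only in the limit do not matter. *)
Lemma esup_seq_leD a b c (e : R^nat) : nondecreasing_seq a ->
  e @ \oo --> 0 -> (forall n, a n <= c + b n + e n) ->
  (esup_seq a <= c%:E + esup_seq b)%E.
Proof.
move=> nda e0 ab; apply: esup_seq_le => n.
apply/lee_addgt0Pr => t t0.
have [m nm et] : exists2 m, (n <= m)%N & e m <= t.
  near \oo => m; exists m; first by near: m; exact: nbhs_infty_ge.
  by near: m; apply: cvgr_le e0 _ _.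
apply: (@le_trans _ _ (c + b m + e m)%:E).
  by rewrite lee_fin; apply: le_trans (ab m); exact: nda.
rewrite !EFinD; apply: leeD; last by rewrite lee_fin.
by apply: leeD2l; exact: esup_seq_ub.
Unshelve. all: by end_near. Qed.

Lemma esup_seq_eqD a b c (e : R^nat) : nondecreasing_seq a -> nondecreasing_seq b ->
  e @ \oo --> 0 -> (forall n, `|a n - b n - c| <= e n) ->
  esup_seq a = (c%:E + esup_seq b)%E.
Proof.
move=> nda ndb e0 ab; apply/eqP; rewrite eq_le; apply/andP; split.
  apply: esup_seq_leD e0 _ => // n; have := ab n.
  by rewrite ler_norml => /andP[]; lra.
rewrite -leeBrDl //; rewrite addeC -EFinN.
apply: esup_seq_leD e0 _ => // n; have := ab n.
by rewrite ler_norml => /andP[]; lra.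
Qed.

Lemma esup_seqD (a b : R^nat) : nondecreasing_seq a -> nondecreasing_seq b ->
  0 <= a 0%N -> 0 <= b 0%N ->
  (esup_seq a + esup_seq b <= esup_seq (fun n => a n + b n)%R)%E.
Proof.
move=> nda ndb a0 b0.
have H : ((a n)%:E + (b n)%:E)%E @[n --> \oo] --> (esup_seq a + esup_seq b)%E.
  apply: cvgeD; [|exact: cvg_esup_seq|exact: cvg_esup_seq].
  apply: ge0_adde_def; rewrite inE.
    by apply: le_trans (esup_seq_ub a 0); rewrite lee_fin.
  by apply: le_trans (esup_seq_ub b 0); rewrite lee_fin.
apply: (cvge_to_le H); apply: nearW => n.
exact: (esup_seq_ub (fun n => a n + b n) n).
Qed.

End suprema.

Section rates.
Context {R : realType} {theta : R} {theta01 : 0 < theta < 1} {d : nat}.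
Local Notation X := (fullshift theta01 d).
Implicit Types (x y z : X) (n m : nat) (u v : X -> R).
Variable eta : R -> probability X R.

Definition rate x n b : R := - (ln (mass (eta b) x n) / b).

Hypothesis eta0 : forall b x n, 0 < b -> 0 < mass (eta b) x n.

Lemma log_rateE x n b : 0 < b -> log_rate eta (cylinder x n) b = (- rate x n b)%:E.
Proof.
by move=> b0; rewrite /log_rate massE lne_EFin ?eta0 // -EFinM /rate opprK mulrC.
Qed.

Lemma rate_ge0 x n b : 0 < b -> 0 <= rate x n b.
Proof.
move=> b0; rewrite oppr_ge0 pmulr_lle0 ?invr_gt0 //.
by apply: ln_le0; exact: mass_le1.
Qed.

Lemma rate_leq x n m b : 0 < b -> (m <= n)%N -> rate x m b <= rate x n b.
Proof.
move=> b0 mn; rewrite lerN2 ler_pM2r ?invr_gt0 // ler_ln ?posrE ?eta0 //.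
exact: mass_leq.
Qed.

Variables (G : set_system R) (J : X -> nat -> R).
Context {GF : ProperFilter G}.
Hypothesis G_pinfty : pinfty_nbhs R `<=` G.
Hypothesis GJ : forall x n, rate x n b @[b --> G] --> J x n.

Let near_gt M : \forall b \near G, M < b.
Proof. by apply: G_pinfty; exact: nbhs_pinfty_gt (num_real _). Qed.

Lemma rate_lim0 x : J x 0 = 0.
Proof.
apply/esym; apply: norm_cvg_unique (@GJ x 0%N) => //.
have -> : rate x 0 = fun=> 0.
  by apply/funext => b; rewrite /rate mass0 ln1 mul0r oppr0.
exact: cvg_cst.
Qed.

Lemma rate_lim_agree x y n : agree n x y -> J x n = J y n.
Proof.
move=> xy; apply/esym; apply: norm_cvg_unique (@GJ x n) => //.
have -> : rate x n = rate y n.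
  by apply/funext => b; rewrite /rate (eq_mass _ xy).
exact: GJ.
Qed.

Lemma rate_lim_nondecreasing x : nondecreasing_seq (J x).
Proof.
move=> m n mn; apply: ler_cvg_to (@GJ x m) (@GJ x n) _.
by near=> b; apply: rate_leq => //; near: b; exact: near_gt.
Unshelve. all: by end_near. Qed.

(** The mass of a cylinder is the sum of the masses of its [d.+1] extensions; if all
of these decayed faster than the cylinder by a fixed rate [t], the factor [d.+1]
would not make up for it. *)
Lemma rate_lim_extend x n : exists a, J (extend x n a) n.+1 <= J x n.
Proof.
pose F a := J (extend x n a) n.+1.
have [a _ amin] := arg_minP (P := xpredT) (i0 := ord0) F isT.
exists a; rewrite leNgt; apply/negP => lt.
(* Two units of the gap separate the children from the parent; one is spent on
   the factor d.+1. *)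
pose t := (F a - J x n) / 3%:R.
have t0 : 0 < t by rewrite divr_gt0 // subr_gt0.
have children : \forall b \near G,
    forall c, J x n + 2 * t < rate (extend x n c) n.+1 b.
  apply: filter_forall => c; apply: (cvgr_gt _ (@GJ (extend x n c) n.+1)).
  have lt' : J x n < F a := lt.
  by apply: lt_le_trans (amin c isT); rewrite /t; lra.
suff : J x n + t <= J x n by rewrite gerDl leNgt t0.
apply: cvgr_to_ge (@GJ x n) _; near=> b.
have b0 : 0 < b by near: b; exact: near_gt.
have child c : J x n + 2 * t < rate (extend x n c) n.+1 b.
  by move: c; near: b.
have card : ln d.+1%:R / b <= t.
  rewrite ler_pdivrMr // -ler_pdivrMl // mulrC; apply: ltW.
  by near: b; exact: near_gt.
have : ln (mass (eta b) x n) <= ln d.+1%:R - b * (J x n + 2 * t).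
  rewrite addrC -le_expRM_ln ?eta0 // mass_splitS mulr_natr.
  rewrite -[X in _ *+ X]card_ord -sumr_const; apply: ler_sum => c _.
  have := child c; rewrite -(ltr_pM2r b0) /rate mulNr divfK ?gt_eqF //.
  move=> lt'; rewrite -[leLHS]lnK ?posrE ?eta0 // ler_expR; move: lt'; lra.
move=> lnm; rewrite -(ler_pM2r b0) /rate mulNr divfK ?gt_eqF //.
by move: card; rewrite ler_pdivrMr //; lra.
Unshelve. all: by end_near. Qed.

Lemma rate_lim_branch x n :
  exists2 y, agree n y x & forall m, (n <= m)%N -> J y m = J x n.
Proof.
apply: (exists_branch (P := fun y m => J y m = J x n)) => //.
- move=> y m ym; have [a am] := rate_lim_extend y m.
  exists a; rewrite -ym; apply/eqP; rewrite eq_le am /=.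
  rewrite -(rate_lim_agree (agree_extend y m a)).
  exact: rate_lim_nondecreasing.
- by move=> y z m /rate_lim_agree ->.
Qed.

Local Notation I x := (esup_seq (J x)).

(** The infimum is attained at the point given by [rate_lim_branch]. *)
Lemma inf_cylinder_esup x n : ereal_inf ((fun y => I y) @` cylinder x n) = (J x n)%:E.
Proof.
apply/eqP; rewrite eq_le; apply/andP; split.
  have [y yx yJ] := rate_lim_branch x n.
  have -> : (J x n)%:E = I y.
    apply/eqP; rewrite eq_le -{1}(yJ n) // esup_seq_ub /=; apply: esup_seq_le => m.
    rewrite lee_fin; have [nm|/ltnW mn] := leqP n m; first by rewrite yJ.
    by rewrite -(yJ n) //; exact: rate_lim_nondecreasing.
  by apply: ereal_inf_lbound; exists y => //; rewrite cylinderE.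
apply: le_ereal_inf_tmp => _ [y + <-]; rewrite cylinderE => /= yx.
by rewrite -(rate_lim_agree yx); exact: esup_seq_ub.
Qed.

Lemma lower_semicontinuous_esup : lower_semicontinuous (fun x => I x).
Proof.
move=> x a /ereal_sup_gt[_ [n _ <-] /= an].
exists (cylinder x n); first exact: nbhs_cylinder.
move=> y; rewrite cylinderE => /= yx; apply: lt_le_trans an _.
by rewrite -(rate_lim_agree yx); exact: esup_seq_ub.
Qed.

Lemma cvg_log_rate x n l : rate x n b @[b --> G] --> l ->
  log_rate eta (cylinder x n) b @[b --> G] --> (- l)%:E.
Proof.
move=> rl; apply/fine_cvgP; split.
  near=> b; rewrite log_rateE //; near: b; exact: near_gt.
apply: cvg_trans (cvgN rl); apply: near_eq_cvg; near=> b => /=.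
rewrite log_rateE //; near: b; exact: near_gt.
Unshelve. all: by end_near. Qed.

End rates.

Section ldp_rates.
Context {R : realType} {theta : R} {theta01 : 0 < theta < 1} {d : nat}.
Local Notation X := (fullshift theta01 d).
Implicit Types (x y z : X) (n m : nat) (u v : X -> R).
Variable eta : R -> probability X R.
Hypothesis eta0 : forall (b : R) x n, 0 < b -> 0 < mass (eta b) x n.

Lemma ldp_rates J : (forall x n, rate eta x n b @[b --> +oo] --> (J x n : R)) ->
  ldp eta (fun x => esup_seq (J x)).
Proof.
move=> etaJ; split.
- move=> x; have := rate_lim0 etaJ x => e.
  by have := esup_seq_ub (J x) 0; rewrite e.
- exact: (lower_semicontinuous_esup etaJ).
- move=> _ [x [n ->]]; rewrite (inf_cylinder_esup eta0 _ etaJ) //.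
  by apply: cvg_log_rate => //; exact: etaJ.
Qed.

(** Logarithmic rates converge as extended reals; a real upper bound on them rules
out an infinite limit. *)
Lemma rate_cvg x n M : cvg (log_rate eta (cylinder x n) b @[b --> +oo]) ->
  (\forall b \near +oo, rate eta x n b <= M) ->
  exists l : R, rate eta x n b @[b --> +oo] --> l.
Proof.
move=> cl rM; set l := lim (log_rate eta (cylinder x n) b @[b --> +oo]) in cl.
have near0 : \forall b \near +oo, 0 < b :> R by exact: nbhs_pinfty_gt (num_real _).
have lfin : l \is a fin_num.
  rewrite fin_numE; apply/andP; split.
    rewrite -ltNye; apply: (@lt_le_trans _ _ (- M)%:E); first exact: ltNyr.
    apply: cvge_to_ge cl _; near=> b.
    have b0 : 0 < b by near: b.
    by rewrite log_rateE // lee_fin lerN2; near: b.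
  rewrite -ltey; apply: (@le_lt_trans _ _ 0%:E); last exact: ltry.
  apply: cvge_to_le cl _; near=> b.
  have b0 : 0 < b by near: b.
  by rewrite log_rateE // lee_fin oppr_le0 rate_ge0.
exists (- fine l); move: cl; rewrite -/l -(fineK lfin) => /fine_cvgP[_ /cvgN cl].
apply: cvg_trans cl; apply: near_eq_cvg; near=> b => /=.
have b0 : 0 < b by near: b.
change (- fine (log_rate eta (cylinder x n) b) = rate eta x n b).
by rewrite log_rateE //= opprK.
Unshelve. all: by end_near. Qed.

End ldp_rates.

Section equivariation.
Context {R : realType} {theta : R} {theta01 : 0 < theta < 1} {d : nat}.
Local Notation X := (fullshift theta01 d).
Implicit Types (x y : X) (n : nat).
Variables (C : R) (F : set_system R) (u : R -> X -> R) (U : X -> R).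
Context {FF : ProperFilter F}.
Hypothesis uC : \forall b \near F, vary C (u b).
Hypothesis uU : forall x, u b x @[b --> F] --> U x.

Lemma vary_lim : vary C U.
Proof.
move=> n x y xy.
apply: (cvgr_to_le (cvg_norm (cvgB (@uU x) (@uU y)))).
by apply: filterS uC => b; apply.
Qed.

(** Up to [C * theta ^ n], a function of variation [C] is determined by its values
at finitely many points, one for each word of length [n]. *)
Lemma vary_uniform_cvg : {uniform, u b @[b --> F] --> U}.
Proof.
have UC := vary_lim; move=> Q /uniform_nbhs[E [entE EQ]].
suff : \forall b \near F, forall y, E (U y, u b y).
  by apply: filterS => b bE; apply: EQ => y _; exact: bE.
move: entE; rewrite -entourage_ballE => -[e /= e0 eE].
have [n ne] := exists_exp_lt (theta01 := theta01) C (divr_gt0 e0 (ltr0n _ 3)).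
have words : \forall b \near F, forall w : {ffun 'I_n -> 'I_d.+1},
    `|U (ffunpt w) - u b (ffunpt w)| < e / 3.
  apply: filter_forall => w.
  by have /cvgrPdist_lt := @uU (ffunpt w); apply; rewrite divr_gt0.
near=> b => y; apply: eE; rewrite /ball /=.
pose w := [ffun j : 'I_n => y j].
have yw : agree n y (ffunpt w) by exact: agree_ffunpt.
have h1 : vary C (u b) by near: b.
have h2 : forall w : {ffun 'I_n -> 'I_d.+1},
    `|U (ffunpt w) - u b (ffunpt w)| < e / 3 by near: b.
have := h1 _ _ _ yw; have := UC _ _ _ yw; have := h2 w.
rewrite !ltr_norml !ler_norml => /andP[? ?] /andP[? ?] /andP[? ?].
by apply/andP; split; lra.
Unshelve. all: by end_near. Qed.

End equivariation.

(** * Zero-temperature limits *)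

Section zero_temperature.
Context {R : realType} {theta : R} {theta01 : 0 < theta < 1} {d : nat}.
Local Notation X := (fullshift theta01 d).
Implicit Types (x y z : X) (n m : nat) (u v : X -> R) (b : R).
Variables (f : X -> R) (mu nu : R -> probability X R) (h : R -> X -> R) (L : R).
Hypothesis fL : vary L f.
Hypothesis mu_eq : forall b : R, 0 < b -> equilibrium (fun x => b * f x) (mu b).
Hypothesis nu_eigen : forall b : R, 0 < b -> eigenmeasure (fun x => b * f x) (nu b).
Hypothesis h_eigen : forall b : R, 0 < b ->
  eigenfunction (fun x => b * f x) (nu b) (h b).
Hypothesis mu_lim :
  forall k, is_cylinder k -> cvg (log_rate mu k b @[b --> +oo%R]).

Local Notation K := (L * (theta / (1 - theta))).
Local Notation C := (L + 2 * K).
Local Notation C2 := (L + K + K / theta).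
Local Notation g b := (normalized_potential (fun x => b * f x) (h b)).

Definition scaled_potential b x : R := - (g b x / b).
Definition scaled_eigenfunction b x : R := ln (h b x) / b.
Definition scaled_pressure b : R := fine (pressure (fun x => b * f x)) / b.

Local Notation Rb := scaled_potential.
Local Notation Vb := scaled_eigenfunction.

Let th0 : 0 < theta := theta_gt0 (theta01 := theta01).
Let th1 : theta < 1 := theta_lt1 (theta01 := theta01).

Let phib b : 0 < b -> vary (b * L) (fun x => b * f x).
Proof. by move=> b0; exact: vary_scale (ltW b0) fL. Qed.

Let K0 : 0 <= K.
Proof.
by rewrite mulr_ge0 ?(vary_ge0 fL) // divr_ge0 ?subr_ge0 ?ltW.
Qed.

Let C0 : 0 <= C.
Proof. by rewrite addr_ge0 ?(vary_ge0 fL) // mulr_ge0. Qed.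

Lemma mass_equilibrium_gt0 b x n : 0 < b -> 0 < mass (mu b) x n.
Proof.
move=> b0; have nuE := nu_eigen b0; have hE := h_eigen b0.
rewrite (equilibrium_eigenstate (phib b0) (mu_eq b0) nuE hE).
by have [] := ln_mass_eigenstate_gt0 (phib b0) nuE hE x n.
Qed.

Lemma mass_eigen_gt0 b x n : 0 < b -> 0 < mass (nu b) x n.
Proof.
by move=> b0; exact: mass_eigenmeasure_gt0 (phib b0) (nu_eigen b0) (h_eigen b0) x n.
Qed.

Let scale b s c : 0 < b -> `|s| <= b * c -> `|s / b| <= c.
Proof.
by move=> b0 sc; rewrite normrM normfV (gtr0_norm b0) ler_pdivrMr // mulrC.
Qed.

Lemma rate_equilibriumS b x n : 0 < b ->
  `|rate mu x n.+1 b - rate mu (sshift x) n b - Rb b x| <= C * theta ^+ n.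
Proof.
move=> b0; have nuE := nu_eigen b0; have hE := h_eigen b0.
have := ln_mass_eigenstateS (phib b0) nuE hE x n.
rewrite -!(equilibrium_eigenstate (phib b0) (mu_eq b0) nuE hE).
have -> : (b * L + 2 * (b * L * (theta / (1 - theta)))) * theta ^+ n =
  b * (C * theta ^+ n) by ring.
move=> /(scale b0); congr (_ <= _); rewrite -normrN; congr `|_|.
by rewrite /rate /scaled_potential; field; rewrite gt_eqF.
Qed.

Lemma rate_eigenmeasure b x n : 0 < b ->
  `|rate nu x n b - rate mu x n b - Vb b x| <= K * theta ^+ n.
Proof.
move=> b0; have nuE := nu_eigen b0; have hE := h_eigen b0.
have [_] := ln_mass_eigenstate_gt0 (phib b0) nuE hE x n.
rewrite -!(equilibrium_eigenstate (phib b0) (mu_eq b0) nuE hE).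
rewrite -!(mulrA b) => /(scale b0); congr (_ <= _); congr `|_|.
by rewrite /rate /scaled_eigenfunction; field; rewrite gt_eqF.
Qed.

Lemma vary_scaled_eigenfunction b : 0 < b -> vary K (Vb b).
Proof.
move=> b0 n x y xy; rewrite /scaled_eigenfunction -mulrBl; apply: scale => //.
have := vary_ln_eigenfunction (phib b0) (h_eigen b0) xy.
by congr (_ <= _); ring.
Qed.

(** The normalization of the eigenfunction enters here: both measures have mass 1,
so that their rates on the whole space vanish. *)
Lemma scaled_eigenfunction_bound b x : 0 < b -> `|Vb b x| <= K.
Proof.
move=> b0; have := rate_eigenmeasure x 0 b0.
by rewrite /rate !mass0 ln1 mul0r oppr0 subrr sub0r normrN expr0 mulr1.
Qed.

Lemma scaled_potential_ge0 b x : 0 < b -> 0 <= Rb b x.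
Proof.
move=> b0; rewrite oppr_ge0 pmulr_lle0 ?invr_gt0 //.
exact: (normalized_potential_le0 (h_eigen b0)).
Qed.

Lemma vary_scaled_potential b : 0 < b -> vary C2 (Rb b).
Proof.
move=> b0 n x y xy.
rewrite /scaled_potential -opprD normrN -mulNr -mulrDl; apply: scale => //.
have := vary_normalized_potential (phib b0) (h_eigen b0) xy; congr (_ <= _).
by field; rewrite (gt_eqF th0) subr_eq0 eq_sym (lt_eqF th1).
Qed.

(** Some preimage of any point has normalized potential at least [- ln d.+1],
because the exponentials over the preimages sum to 1; the variation does the
rest. *)
Lemma scaled_potential_le b x : 0 < b -> Rb b x <= C2 + ln d.+1%:R / b.
Proof.
move=> b0; have hE := h_eigen b0.
have [a ga] : exists a, - ln d.+1%:R <= g b (prepend a x).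
  apply/not_existsP => lt.
  have : \sum_(a < d.+1) expR (g b (prepend a x)) < \sum_(a < d.+1) expR (- ln d.+1%:R).
    apply: ltr_sum => [|a _]; first by apply/hasP; exists ord0; rewrite ?mem_index_enum.
    by rewrite ltr_expR ltNge; apply/negP; exact: lt.
  rewrite (sum_normalized_potential hE) sumr_const card_ord expRN lnK ?posrE //.
  by rewrite -[X in _ < X]mulr_natr mulVf ?pnatr_eq0 // ltxx.
have := vary_dist (vary_scaled_potential b0) x (prepend a x).
rewrite ler_norml => /andP[_]; rewrite lerBlDr => /le_trans; apply.
by rewrite lerD2l /scaled_potential -mulNr ler_pM2r ?invr_gt0 // lerNl.
Qed.

Lemma scaled_potentialE b x : 0 < b ->
  Rb b x = scaled_pressure b - f x - Vb b x + Vb b (sshift x).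
Proof.
move=> b0; rewrite /scaled_potential /scaled_pressure /scaled_eigenfunction.
by rewrite /normalized_potential; field; rewrite gt_eqF.
Qed.

Lemma rate_equilibrium_le b x n : 1 <= b ->
  rate mu x n b <= n%:R * (C + C2 + ln d.+1%:R).
Proof.
move=> b1; have b0 : 0 < b by exact: lt_le_trans b1.
elim: n x => [|n IH] x; first by rewrite /rate mass0 ln1 mul0r oppr0 mul0r.
have := rate_equilibriumS x n b0; have := IH (sshift x).
have := scaled_potential_le x b0.
have lnb : ln d.+1%:R / b <= ln d.+1%:R :> R.
  by rewrite ler_pdivrMr // ler_peMr // ln_ge0 // ler1n.
have tn : C * theta ^+ n <= C.
  by rewrite ler_piMr // exprn_ile1 // ltW.
rewrite ler_norml -[n.+1%:R]natr1 => h1 h2 /andP[_ h3].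
by move: h1 h2 h3 lnb tn; lra.
Qed.

Let near_pos M : \forall b \near +oo, M < b :> R.
Proof. exact: nbhs_pinfty_gt (num_real _). Qed.

Lemma rate_equilibrium_cvg x n : exists l : R, rate mu x n b @[b --> +oo] --> l.
Proof.
case: n => [|n].
  exists 0; have -> : rate mu x 0 = fun=> 0.
    by apply/funext => b; rewrite /rate mass0 ln1 mul0r oppr0.
  exact: cvg_cst.
apply: (@rate_cvg _ _ _ _ mu _ x n.+1 (n.+1%:R * (C + C2 + ln d.+1%:R))).
- by move=> b y m; exact: mass_equilibrium_gt0.
- by apply: mu_lim; exists x, n.
- near=> b; apply: rate_equilibrium_le; apply: ltW; near: b; exact: near_pos.
Unshelve. all: by end_near. Qed.

Definition mu_rate x n : R := sval (cid (rate_equilibrium_cvg x n)).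
Local Notation J := mu_rate.

Lemma mu_rateP x n : rate mu x n b @[b --> +oo] --> J x n.
Proof. by rewrite /mu_rate; case: cid. Qed.

Definition mu_deviation x : \bar R := esup_seq (J x).
Local Notation I := mu_deviation.

Lemma mu_rate_nondecreasing x : nondecreasing_seq (J x).
Proof.
apply: (rate_lim_nondecreasing _ _ mu_rateP) => //.
by move=> b y m; exact: mass_equilibrium_gt0.
Qed.

Lemma log_rate_lim x n :
  lim (log_rate mu (cylinder x n) b @[b --> +oo%R]) = (- J x n)%:E.
Proof.
apply: cvg_lim => //; apply: cvg_log_rate => //; last exact: mu_rateP.
by move=> b y m; exact: mass_equilibrium_gt0.
Qed.

Lemma cvg_lim_log_rate x :
  (fun n => lim (log_rate mu (cylinder x n) b @[b --> +oo%R])) @ \oo --> (- I x)%E.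
Proof.
have -> : (fun n => lim (log_rate mu (cylinder x n) b @[b --> +oo%R])) =
    (fun n => (- (J x n)%:E)%E).
  by apply/funext => n; rewrite log_rate_lim.
apply: cvgeN; apply: cvg_esup_seq; exact: mu_rate_nondecreasing.
Qed.

Lemma deviationE : deviation mu = I.
Proof.
apply/funext => x; rewrite /deviation (cvg_lim _ (@cvg_lim_log_rate x)) //.
by rewrite oppeK.
Qed.

Let G0 : {G : set_system R | UltraFilter G /\ pinfty_nbhs R `<=` G}.
Proof.
apply: cid; have FP : ProperFilter (pinfty_nbhs R) by exact: proper_pinfty_nbhs.
by have [G] := ultraFilterLemma FP; exists G.
Qed.

Section along_ultrafilter.
Variable G : set_system R.
Hypotheses (GU : UltraFilter G) (Goo : pinfty_nbhs R `<=` G).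

Let nearG M : \forall b \near G, M < b.
Proof. by apply: Goo; exact: near_pos. Qed.

Lemma scaled_potential_ultra x : exists l : R, Rb b x @[b --> G] --> l /\
  forall n, `|J x n.+1 - J (sshift x) n - l| <= C * theta ^+ n.
Proof.
have [l Rl] : exists l : R, Rb b x @[b --> G] --> l.
  apply: (@bounded_ultra_cvg _ _ _ GU _ (C2 + ln d.+1%:R)) => //.
  near=> b; have b1 : 1 < b by near: b.
  have b0 : 0 < b by exact: lt_trans b1.
  rewrite ger0_norm ?scaled_potential_ge0 //.
  apply: le_trans (scaled_potential_le x b0) _.
  by rewrite lerD2l ler_pdivrMr // ler_peMr ?ln_ge0 ?ler1n // ltW.
exists l; split=> // n.
have JG y m : rate mu y m b @[b --> G] --> J y m.
  by apply: cvg_trans (@mu_rateP y m); apply: cvg_app.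
apply: (cvgr_to_le (cvg_norm (cvgB (cvgB (@JG x n.+1) (@JG (sshift x) n)) Rl))).
near=> b; apply: rate_equilibriumS; near: b; exact: nearG.
Unshelve. all: by end_near. Qed.

End along_ultrafilter.

(** The limit along one ultrafilter, chosen once and for all; [subactionP]
determines it. *)
Definition subaction x : R :=
  sval (cid (scaled_potential_ultra (svalP G0).1 (svalP G0).2 x)).
Local Notation Rp := subaction.

Lemma subactionP x n : `|J x n.+1 - J (sshift x) n - Rp x| <= C * theta ^+ n.
Proof.
have [_] := svalP (cid (scaled_potential_ultra (svalP G0).1 (svalP G0).2 x)).
exact.
Qed.

Lemma scaled_potential_cvg x : Rb b x @[b --> +oo] --> Rp x.
Proof.
apply: cvg_ultra => G GU Goo.
have [l [Rl lJ]] := scaled_potential_ultra GU Goo x.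
suff <- : l = Rp x by [].
apply: (exp_theta_eq (theta01 := theta01) (c := 2 * C)) => n.
have := lJ n; have := subactionP x n.
rewrite !ler_norml => /andP[? ?] /andP[? ?]; apply/andP; split; lra.
Qed.

Lemma vary_subaction : vary C2 Rp.
Proof.
apply: (@vary_lim _ _ _ _ C2 (pinfty_nbhs R) Rb _ _ _ scaled_potential_cvg).
near=> b; apply: vary_scaled_potential; near: b; exact: near_pos.
Unshelve. all: by end_near. Qed.

Lemma scaled_potential_uniform : {uniform, Rb b @[b --> +oo] --> Rp}.
Proof.
apply: (@vary_uniform_cvg _ _ _ _ C2 (pinfty_nbhs R) Rb _ _ _ scaled_potential_cvg).
near=> b; apply: vary_scaled_potential; near: b; exact: near_pos.
Unshelve. all: by end_near. Qed.

Lemma subaction_ge0 x : 0 <= Rp x.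
Proof.
apply: (cvgr_to_ge (@scaled_potential_cvg x)).
near=> b; apply: scaled_potential_ge0; near: b; exact: near_pos.
Unshelve. all: by end_near. Qed.

Lemma mu_deviationE x : I x = ((Rp x)%:E + I (sshift x))%E.
Proof.
have -> : I x = esup_seq (fun n => J x n.+1).
  apply/eqP; rewrite eq_le; apply/andP; split; apply: esup_seq_le => n.
    apply: le_trans (esup_seq_ub _ n); rewrite lee_fin.
    exact: mu_rate_nondecreasing.
  exact: esup_seq_ub.
apply: (esup_seq_eqD (e := fun n => C * theta ^+ n)).
- by move=> m n mn; apply: mu_rate_nondecreasing.
- exact: mu_rate_nondecreasing.
- rewrite -[X in _ --> X](mulr0 C); apply: cvgMr.
  exact: (theta_exp_cvg0 (theta01 := theta01)).
- exact: subactionP.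
Qed.

Let p : R := Rp point + f point.

(** At a fixed point of the shift the eigenfunction drops out of the normalized
potential. *)
Lemma scaled_pressure_cvg : scaled_pressure b @[b --> +oo] --> p.
Proof.
have H : Rb b point + f point @[b --> +oo] --> p.
  by apply: cvgD; [exact: scaled_potential_cvg|exact: cvg_cst].
apply: cvg_trans H; apply: near_eq_cvg; near=> b.
have b0 : 0 < b by near: b; exact: near_pos.
by rewrite scaled_potentialE //; have -> : sshift point = point :> X by []; ring.
Unshelve. all: by end_near. Qed.

Section eigenfunction_limit.
Variable G : set_system R.
Hypotheses (GU : UltraFilter G) (Goo : pinfty_nbhs R `<=` G).

Let nearG M : \forall b \near G, M < b.
Proof. by apply: Goo; exact: near_pos. Qed.

Lemma scaled_eigenfunction_ultra : exists V : X -> R,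
  [/\ (forall x, Vb b x @[b --> G] --> V x), vary K V,
      (forall x, Rp x = p - f x - V x + V (sshift x)) &
      exists2 J' : X -> nat -> R,
        (forall x n, rate nu x n b @[b --> G] --> J' x n) &
        forall x, esup_seq (J' x) = ((V x)%:E + I x)%E].
Proof.
have Vex x : exists l : R, Vb b x @[b --> G] --> l.
  apply: (@bounded_ultra_cvg _ _ _ GU _ K) => //.
  by near=> b; apply: scaled_eigenfunction_bound; near: b; exact: nearG.
have [V VP] := choice Vex.
have VK : vary K V.
  apply: (@vary_lim _ _ _ _ K G Vb _ _ _ VP).
  near=> b; apply: vary_scaled_eigenfunction; near: b; exact: nearG.
have JG y m : rate mu y m b @[b --> G] --> J y m.
  by apply: cvg_trans (@mu_rateP y m); apply: cvg_app.
have RG y : Rb b y @[b --> G] --> Rp y.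
  by apply: cvg_trans (@scaled_potential_cvg y); apply: cvg_app.
have pG : scaled_pressure b @[b --> G] --> p.
  by apply: cvg_trans scaled_pressure_cvg; apply: cvg_app.
exists V; split => // [x|].
  apply: norm_cvg_unique (@RG x) _.
  have H : scaled_pressure b - f x - Vb b x + Vb b (sshift x) @[b --> G] -->
      p - f x - V x + V (sshift x).
    apply: cvgD; last exact: VP.
    by apply: cvgB; [apply: cvgB => //; exact: cvg_cst|exact: VP].
  apply: cvg_trans H; apply: near_eq_cvg; near=> b.
  have b0 : 0 < b by near: b; exact: nearG.
  by rewrite scaled_potentialE.
have J'ex (xn : X * nat) : exists l : R, rate nu xn.1 xn.2 b @[b --> G] --> l.
  case: xn => x n /=.
  apply: (@bounded_ultra_cvg _ _ _ GU _ (n%:R * (C + C2 + ln d.+1%:R) + 2 * K)) => //.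
  near=> b; have b1 : 1 < b by near: b.
  have b0 : 0 < b by exact: lt_trans b1.
  rewrite ger0_norm; last by apply: rate_ge0.
  have := rate_eigenmeasure x n b0; have := scaled_eigenfunction_bound x b0.
  have := rate_equilibrium_le x n (ltW b1).
  have : K * theta ^+ n <= K by rewrite ler_piMr // exprn_ile1 // ltW.
  rewrite !ler_norml => ? ? /andP[_ ?] /andP[_ ?].
  lra.
have [J' J'P] := choice J'ex.
exists (fun x n => J' (x, n)) => [x n|x]; first exact: (J'P (x, n)).
apply: (esup_seq_eqD (e := fun n => K * theta ^+ n)).
- move=> m n mn; apply: (@rate_lim_nondecreasing _ _ _ _ nu _ G (fun x n => J' (x, n))) => //.
    by move=> b y k; exact: mass_eigen_gt0.
  by move=> y k; exact: (J'P (y, k)).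
- exact: mu_rate_nondecreasing.
- rewrite -[X in _ --> X](mulr0 K); apply: cvgMr.
  exact: (theta_exp_cvg0 (theta01 := theta01)).
move=> n.
apply: (cvgr_to_le (cvg_norm (cvgB (cvgB (J'P (x, n)) (@JG x n)) (@VP x)))).
near=> b; apply: rate_eigenmeasure; near: b; exact: nearG.
Unshelve. all: by end_near. Qed.

End eigenfunction_limit.

(** Two limits of the scaled eigenfunctions differ by a shift invariant function of
controlled variation, hence by a constant. Its sign is seen at a point where
[V + I] vanishes; such a point exists because [nu b] has total mass 1. *)
Lemma eigenfunction_limit_le V V' (G : set_system R) (GU : UltraFilter G)
    (Goo : pinfty_nbhs R `<=` G) (J' : X -> nat -> R) :
  vary K V -> vary K V' ->
  (forall x, Rp x = p - f x - V x + V (sshift x)) ->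
  (forall x, Rp x = p - f x - V' x + V' (sshift x)) ->
  (forall x, (0 <= (V' x)%:E + I x)%E) ->
  (forall x n, rate nu x n b @[b --> G] --> J' x n) ->
  (forall x, esup_seq (J' x) = ((V x)%:E + I x)%E) ->
  forall x, V x <= V' x.
Proof.
move=> VK V'K RV RV' IV' J'P J'I.
pose D x := V' x - V x.
have Dinv x : D (sshift x) = D x by have := RV x; rewrite RV' /D; lra.
have Diter n x : D (iter n sshift x) = D x 
  by elim: n => [//|n IH]; rewrite iterS Dinv.
(* x_1 ... x_n y is close to x and is mapped to y by the n-th iterate. *)
have Dcst x y : D x = D y.
  apply: (exp_theta_eq (theta01 := theta01) (c := 2 * K)) => n.
  have := Diter n (concat x n y); rewrite iter_concat => ->.
  have xy := agree_sym (agree_concat n x y).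
  have := VK _ _ _ xy; have := V'K _ _ _ xy; rewrite /D.
  by rewrite !ler_norml => /andP[? ?] /andP[? ?]; apply/andP; split; lra.
have nu0 b y k : 0 < b -> 0 < mass (nu b) y k by exact: mass_eigen_gt0.
have [y _ yJ] := rate_lim_branch nu0 Goo J'P point 0.
have Iy : ((V y)%:E + I y = 0)%E.
  rewrite -J'I; apply/eqP; rewrite eq_le; apply/andP; split.
    by apply: esup_seq_le => n; rewrite yJ // (rate_lim0 J'P).
  by have := esup_seq_ub (J' y) 0; rewrite (rate_lim0 J'P).
have Dy : 0 <= D y.
  have := IV' y; move: Iy; case: (I y) => [r| |] //=.
  by rewrite -!EFinD lee_fin /D => -[]; lra.
by move=> x; rewrite -subr_ge0 -/(D x) (Dcst x y).
Qed.

Lemma scaled_eigenfunction_limit : exists V : X -> R,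
  [/\ (forall x, Vb b x @[b --> +oo] --> V x), vary K V,
      (forall x, Rp x = p - f x - V x + V (sshift x)) &
      ldp nu (fun x => I x + (V x)%:E)%E].
Proof.
have [G [GU Goo]] := G0.
have nu0 b y k : 0 < b -> 0 < mass (nu b) y k by exact: mass_eigen_gt0.
have [V [VP VK RV [J' J'P J'I]]] := scaled_eigenfunction_ultra GU Goo.
have V0 x : (0 <= (V x)%:E + I x)%E.
  by rewrite -J'I; have := esup_seq_ub (J' x) 0; rewrite (rate_lim0 J'P).
have unique G' (GU' : UltraFilter G') (Goo' : pinfty_nbhs R `<=` G') :
    (forall x, Vb b x @[b --> G'] --> V x) /\
    (forall x n, rate nu x n b @[b --> G'] --> J' x n).
  have [V' [V'P V'K RV' [J2 J2P J2I]]] := scaled_eigenfunction_ultra GU' Goo'.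
  have V'0 x : (0 <= (V' x)%:E + I x)%E.
    by rewrite -J2I; have := esup_seq_ub (J2 x) 0; rewrite (rate_lim0 J2P).
  have VV' : V = V'.
    apply/funext => x; apply/eqP; rewrite eq_le.
    rewrite (eigenfunction_limit_le GU Goo VK V'K RV RV' V'0 J'P J'I).
    by rewrite (eigenfunction_limit_le GU' Goo' V'K VK RV' RV V0 J2P J2I).
  split; first by rewrite VV'.
  suff -> : J' = J2 by [].
  apply/funext => x; apply/funext => n; apply: EFin_inj.
  rewrite -(inf_cylinder_esup nu0 Goo J'P) -(inf_cylinder_esup nu0 Goo' J2P).
  congr (ereal_inf (_ @` _)); apply/funext => y.
  by rewrite J'I J2I VV'.
exists V; split => //.
  by move=> x; apply: cvg_ultra => G' GU' Goo'; exact: (unique G' GU' Goo').1.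
have -> : (fun x => (I x + (V x)%:E)%E) = (fun x => esup_seq (J' x)).
  by apply/funext => x; rewrite J'I addeC.
apply: ldp_rates => // x n.
by apply: cvg_ultra => G' GU' Goo'; exact: (unique G' GU' Goo').2.
Qed.

Lemma scaled_eigenfunction_uniform V : (forall x, Vb b x @[b --> +oo] --> V x) ->
  {uniform, Vb b @[b --> +oo] --> V}.
Proof.
move=> VV; apply: (@vary_uniform_cvg _ _ _ _ K (pinfty_nbhs R) Vb _ _ _ VV).
near=> b; apply: vary_scaled_eigenfunction; near: b; exact: near_pos.
Unshelve. all: by end_near. Qed.


End zero_temperature.

(** * Probabilities with prescribed masses of cylinders *)

Section measure_of_weights.
Context {R : realType} {theta : R} {theta01 : 0 < theta < 1} {d : nat}.
Local Notation X := (fullshift theta01 d).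
Implicit Types (x y z : X) (n m : nat) (w : seq 'I_d.+1).
Variable p : seq 'I_d.+1 -> R.
Hypothesis p_nil : p [::] = 1.
Hypothesis p_ge0 : forall w, 0 <= p w.
Hypothesis p_rcons : forall w, p w = \sum_(a < d.+1) p (rcons w a).

Let below w k : R := \sum_(a < d.+1 | (a < k)%N) p (rcons w a).

(** The words of length [n] cut the unit interval, in lexicographic order, into
intervals whose lengths are their weights; [cell x n] is the interval of the
first [n] letters of [x]. Coding a number by the intervals that contain it
transports the Lebesgue measure to the required probability. *)
Fixpoint cell_left x n : R :=
  if n is m.+1 then cell_left x m + below (mkseq x m) (x m) else 0.

Definition cell x n : set R :=
  [set` `[cell_left x n, cell_left x n + p (mkseq x n)[].

Let below0 w : below w 0 = 0.
Proof. by rewrite /below big_pred0. Qed.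

Let belowS w (a : 'I_d.+1) : below w a.+1 = below w a + p (rcons w a).
Proof.
rewrite /below (bigD1 a) ?ltnSn //= addrC; congr (_ + _); apply: eq_bigl => i.
by rewrite ltnS -val_eqE /= ltn_neqAle andbC.
Qed.

Let below_le w k l : (k <= l)%N -> below w k <= below w l.
Proof.
move=> kl; rewrite /below [leRHS](bigID (fun a : 'I_d.+1 => (a < k)%N)) /=.
have -> : \sum_(i < d.+1 | (i < l)%N && (i < k)%N) p (rcons w i) =
    \sum_(i < d.+1 | (i < k)%N) p (rcons w i).
  apply: eq_bigl => i; case: (ltnP i k) => [ik|]; rewrite ?andbF ?andbT //.
  exact: leq_trans ik kl.
by rewrite lerDl; apply: sumr_ge0.
Qed.

Let below_all w : below w d.+1 = p w.
Proof. by rewrite p_rcons /below; apply: eq_bigl => a; rewrite ltn_ord. Qed.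

Lemma eq_cell_left x y n : agree n x y -> cell_left x n = cell_left y n.
Proof.
elim: n => [//|n IH] xy /=; have xy' := agree_leq (leqnSn n) xy.
by rewrite (IH xy') xy'; have /agreeP -> := xy.
Qed.

Lemma eq_cell x y n : agree n x y -> cell x n = cell y n.
Proof. by move=> xy; rewrite /cell (eq_cell_left xy) xy. Qed.

Lemma cell0 x : cell x 0 = [set` `[0, 1[].
Proof. by rewrite /cell /= add0r p_nil. Qed.

Lemma cellS_sub x n : cell x n.+1 `<=` cell x n.
Proof.
move=> t; rewrite /cell /= !in_itv /= mkseqS -addrA -belowS => /andP[h1 h2].
apply/andP; split.
  by apply: le_trans h1; rewrite lerDl -(below0 (mkseq x n)); exact: below_le.
apply: lt_le_trans h2 _; rewrite lerD2l -below_all; apply: below_le.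
exact: ltn_ord.
Qed.

Lemma cell_extend x n t : cell x n t -> exists a, cell (extend x n a) n.+1 t.
Proof.
rewrite /cell /= in_itv /= => /andP[h1 h2].
(* The letter sought precedes the first one whose interval starts after t. *)
have ex : exists k, t < cell_left x n + below (mkseq x n) k.
  by exists d.+1; rewrite below_all.
case: (ex_minnP ex) => -[|k]; first by rewrite below0 addr0 ltNge h1.
move=> hk min.
have kd : (k < d.+1)%N by apply: min; rewrite below_all.
exists (Ordinal kd); have e := agree_extend x n (Ordinal kd).
rewrite in_itv /= mkseqS e extendE (eq_cell_left e) -addrA -belowS hk andbT.
by rewrite leNgt; apply/negP => /min; rewrite ltnn.
Qed.

Lemma cell_agree x y n t : cell x n t -> cell y n t -> agree n x y.
Proof.
elim: n => [//|n IH] xt yt.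
have xy : agree n x y by apply: IH; exact: cellS_sub.
(* Sibling intervals are ordered like their last letters. *)
have nlt u v : cell u n.+1 t -> cell v n.+1 t -> agree n u v -> (u n <= v n)%N.
  rewrite /cell /= !in_itv /= !mkseqS => /andP[u1 _] /andP[_ v2] uv.
  rewrite leqNgt; apply/negP => lt.
  have := lt_le_trans v2 (le_trans _ u1); rewrite ltxx => /(_ _)/negP; apply => //.
  rewrite -addrA -belowS -(eq_cell_left uv) uv lerD2l; exact: below_le.
apply: agreeSr => //; apply/val_inj/eqP; rewrite eqn_leq; apply/andP.
by split; apply: nlt => //; exact: agree_sym.
Qed.

Let unit_itv : set R := [set` `[0, 1[].

Let code_ex t : exists y : X, unit_itv t -> forall n, cell y n t.
Proof.
have [t01|] := pselect (unit_itv t); last by exists point.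
have [|||y _ yt] := @exists_branch R theta theta01 d (fun y n => cell y n t) point 0.
- by move=> y m; exact: cell_extend.
- by move=> y z m /eq_cell ->.
- by rewrite cell0.
by exists y => _ n; exact: yt.
Qed.

Definition code t : X := sval (cid (code_ex t)).

Lemma codeP t n : unit_itv t -> cell (code t) n t.
Proof. by move=> t01; exact: (svalP (cid (code_ex t)) t01). Qed.

Lemma preimage_code_cylinder x n : unit_itv `&` code @^-1` cylinder x n = cell x n.
Proof.
apply/seteqP; split=> [t [t01]|t xt].
  by rewrite cylinderE /= => e; rewrite -(eq_cell e); exact: codeP.
have t01 : unit_itv t.
  rewrite /unit_itv -(cell0 x); elim: n xt => // n IH /cellS_sub; exact: IH.
split => //; rewrite cylinderE /=; exact: cell_agree (codeP n t01) xt.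
Qed.

Lemma measurable_code : measurable_fun unit_itv code.
Proof.
apply: (measurability _ (@measurable_cylinders R theta theta01 d)) => _ [A + <-].
case=> [->|[w ->]]; first by rewrite preimage_set0 setI0; exact: measurable0.
by rewrite cylE preimage_code_cylinder; exact: measurable_itv.
Qed.

Definition weight_measure (A : set X) : \bar R :=
  lebesgue_measure (unit_itv `&` code @^-1` A).

Let m0 : weight_measure set0 = 0%E.
Proof. by rewrite /weight_measure preimage_set0 setI0 measure0. Qed.

Let m_ge0 A : (0 <= weight_measure A)%E. Proof. exact: measure_ge0. Qed.

Let m_sigma_additive : semi_sigma_additive weight_measure.
Proof.
move=> F mF tF mUF; rewrite /weight_measure preimage_bigcup setI_bigcupr.
apply: measure_semi_sigma_additive.
- by move=> n; apply: measurable_code => //; exact: measurable_itv.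
- apply/trivIsetP => i j _ _ ij; rewrite setIACA setIid -preimage_setI.
  by move/trivIsetP : tF => /(_ _ _ _ _ ij) ->//; rewrite preimage_set0 setI0.
- rewrite -setI_bigcupr -preimage_bigcup.
  by apply: measurable_code => //; exact: measurable_itv.
Qed.

HB.instance Definition _ := isMeasure.Build _ _ _
  weight_measure m0 m_ge0 m_sigma_additive.

Lemma weight_measure_cylinder x n : weight_measure (cylinder x n) = (p (mkseq x n))%:E.
Proof.
rewrite /weight_measure preimage_code_cylinder lebesgue_measure_itv /= lte_fin.
rewrite ltrDl; case: ltP => [_|p0]; first by rewrite -EFinB addrAC subrr add0r.
by congr (_%:E); apply/eqP; rewrite eq_le p_ge0.
Qed.

Let m_setT : weight_measure setT = 1%E.
Proof. by rewrite -(cylinder0 point) weight_measure_cylinder p_nil. Qed.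

HB.instance Definition _ := Measure_isProbability.Build _ _ _ weight_measure m_setT.

Lemma exists_probability : exists rho : probability X R,
  forall x n, mass rho x n = p (mkseq x n).
Proof.
exists [the probability X R of weight_measure] => x n.
by rewrite /mass /= weight_measure_cylinder.
Qed.

End measure_of_weights.

(** * Invariant probabilities on limit sets of orbits *)

Section krylov_bogolyubov.
Context {R : realType} {theta : R} {theta01 : 0 < theta < 1} {d : nat}.
Local Notation X := (fullshift theta01 d).
Implicit Types (x y z : X) (n m : nat) (w : seq 'I_d.+1) (u : X -> R).

Section frequencies.
Variable x : X.

Let visits w j : R := (mkseq (iter j sshift x) (size w) == w)%:R.

Definition freq w N : R := (\sum_(0 <= j < N) visits w j) / N%:R.

Let visits01 w j : 0 <= visits w j <= 1.
Proof. by rewrite /visits; case: (_ == _); rewrite ?lexx ler01. Qed.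

Let freq_bound w N : `|freq w N| <= 1.
Proof.
case: N => [|N]; first by rewrite /freq big_nil mul0r normr0.
rewrite ger0_norm; last first.
  by rewrite divr_ge0 // sumr_ge0 // => j _; case/andP: (visits01 w j).
rewrite ler_pdivrMr ?ltr0n // mul1r -[leRHS]mulr1 -[X in X%:R * _]subn0.
rewrite mulr_natl -sumr_const_nat; apply: ler_sum => j _.
by case/andP: (visits01 w j).
Qed.

Variable G : set_system nat.
Hypotheses (GU : UltraFilter G) (Goo : \oo `<=` G).

Let cvg_oo (v : nat -> R) (l : R) : v @ \oo --> l -> v @ G --> l.
Proof. by apply: cvg_trans; exact: cvg_app. Qed.

Let freq_ex w : exists l : R, freq w N @[N --> G] --> l.
Proof.
apply: (@bounded_ultra_cvg _ _ _ GU _ 1); apply: nearW => N; exact: freq_bound.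
Qed.

Let p w : R := sval (cid (freq_ex w)).

Let pP w : freq w N @[N --> G] --> p w.
Proof. exact: svalP (cid (freq_ex w)). Qed.

Let p_nil : p [::] = 1.
Proof.
apply: norm_cvg_unique (@pP [::]) _; apply: cvg_oo.
apply: cvg_near_cst; exists 1%N => // N /= N0.
rewrite /freq (eq_bigr (fun=> 1)); last by move=> j _; rewrite /visits.
by rewrite sumr_const_nat subn0 divff // pnatr_eq0 -lt0n.
Qed.

Let p_ge0 w : 0 <= p w.
Proof.
apply: (cvgr_to_ge (@pP w)); apply: nearW => N.
by rewrite divr_ge0 // sumr_ge0 // => j _; case/andP: (visits01 w j).
Qed.

Let cvg_freq_sum (v : 'I_d.+1 -> seq 'I_d.+1) :
  \sum_(a < d.+1) freq (v a) N @[N --> G] --> \sum_(a < d.+1) p (v a).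
Proof. apply: cvg_big => //; first [exact: add_continuous|by move=> a _; exact: pP]. Qed.

Let p_rcons w : p w = \sum_(a < d.+1) p (rcons w a).
Proof.
apply: norm_cvg_unique (@pP w) _.
suff -> : freq w = fun N => \sum_(a < d.+1) freq (rcons w a) N by exact: cvg_freq_sum.
apply/funext => N; rewrite /freq -mulr_suml exchange_big /=; congr (_ / _).
apply: eq_bigr => j _; rewrite /visits.
under [RHS]eq_bigr => a _ do rewrite size_rcons mkseqS eqseq_rcons.
case: (_ == w); last by rewrite big1.
rewrite (bigD1 (iter j sshift x (size w))) //= eqxx big1 ?addr0 // => a.
by rewrite eq_sym => /negbTE ->.
Qed.

(** The numbers of visits to [w] and to its preimage differ by the first and the
last term only. *)
Let p_cons w : p w = \sum_(a < d.+1) p (a :: w).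
Proof.
have H : freq w N - \sum_(a < d.+1) freq (a :: w) N @[N --> G] -->
    p w - \sum_(a < d.+1) p (a :: w).
  by apply: cvgB => //; exact: cvg_freq_sum.
have freqE N : freq w N - \sum_(a < d.+1) freq (a :: w) N =
    (visits w 0 - visits w N) / N%:R.
  rewrite /freq -mulr_suml -mulrBl exchange_big /= -sumrB; congr (_ / _).
  rewrite -(opprB (visits w N)) -telescope_sumr // -sumrN; apply: eq_bigr => j _.
  rewrite opprB; congr (_ - _); rewrite /visits iterS.
  under eq_bigr => a _ do rewrite /= mkseq_sshift eqseq_cons.
  case: (_ == w); last by rewrite big1 // => a _; rewrite andbF.
  rewrite (bigD1 (iter j sshift x 0%N)) //= eqxx big1 ?addr0 // => a.
  by rewrite eq_sym => /negbTE ->.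
apply/eqP; rewrite -subr_eq0 -normr_le0; apply/ler_addgt0Pr => e e0.
rewrite add0r; apply: (cvgr_to_le (cvg_norm H)); apply: Goo.
near=> N; rewrite freqE normrM normfV.
have N0 : 0 < N%:R :> R by rewrite ltr0n; near: N; exact: nbhs_infty_gt.
rewrite (gtr0_norm N0) ler_pdivrMr //; apply: (@le_trans _ _ 1).
  have /andP[? ?] := visits01 w 0; have /andP[? ?] := visits01 w N.
  by rewrite ler_norml; apply/andP; split; lra.
rewrite -ler_pdivrMl // mulr1; near: N; exact: nbhs_infty_ger.
Unshelve. all: by end_near. Qed.

Let p_visits w : 0 < p w ->
  forall N, exists2 j, (N <= j)%N & mkseq (iter j sshift x) (size w) = w.
Proof.
move=> p0 N; apply: contrapT => nv; move: p0; rewrite lt_neqAle => /andP[/eqP + _].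
apply; apply/esym/eqP; rewrite -normr_le0; apply/ler_addgt0Pr => e e0.
rewrite add0r; apply: (cvgr_to_le (cvg_norm (@pP w))); apply: Goo.
near=> M.
have M0 : 0 < M%:R :> R by rewrite ltr0n; near: M; exact: nbhs_infty_gt.
have NM : (N <= M)%N by near: M; exact: nbhs_infty_ge.
rewrite /freq normrM normfV (gtr0_norm M0) ler_pdivrMr //.
rewrite (big_cat_nat (leq0n N) NM) //=.
have -> : \sum_(N <= j < M) visits w j = 0.
  rewrite big_nat big1 // => j /andP[Nj _]; rewrite /visits.
  case: eqP => // jw; exfalso; apply: nv.
  by exists j.
rewrite addr0; apply: (@le_trans _ _ N%:R); last first.
  by rewrite -ler_pdivrMl // mulrC; near: M; exact: nbhs_infty_ger.
rewrite ger0_norm; last by apply: sumr_ge0 => j _; case/andP: (visits01 w j).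
rewrite -[leRHS]mulr1 -[X in X%:R * _]subn0.
rewrite mulr_natl -sumr_const_nat; apply: ler_sum => j _.
by case/andP: (visits01 w j).
Unshelve. all: by end_near. Qed.

Lemma ultra_krylov_bogolyubov : exists rho : probability X R, shift_invariant rho /\
  forall y n, 0 < mass rho y n ->
    forall N, exists2 j, (N <= j)%N & agree n (iter j sshift x) y.
Proof.
have [rho rhoE] := @exists_probability R theta theta01 d p p_nil p_ge0 p_rcons.
exists rho; split; last first.
  move=> y n; rewrite rhoE => /p_visits + N => /(_ N)[j Nj].
  by rewrite size_mkseq => e; exists j.
apply: shift_invariant_cylinders => y n.
have -> : sshift @^-1` cylinder y n =
    \big[setU/set0]_(a < d.+1) cylinder (prepend a y) n.+1.
  apply/seteqP; split=> z.
    rewrite /preimage /= cylinderE -bigcup_mkord_ord /= => zy; exists (z 0%N) => //=.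
    rewrite inord_val cylinderE /= -[z in agree _ z _]prepend_sshift.
    exact: agree_prepend.
  by rewrite -bigcup_mkord_ord => -[a _]; rewrite /preimage !cylinderE /= => /agree_sshift.
rewrite measure_bigsetU_ord //=.
- rewrite massE rhoE p_cons -sumEFin; apply: eq_bigr => a _.
  by rewrite massE rhoE mkseq_sshift.
- by move=> a; exact: measurable_cylinder.
- apply/trivIsetP => a b _ _ ab; apply/seteqP; split=> // z.
  rewrite !cylinderE /= => -[/agreeP/(_ 0%N isT) + /agreeP/(_ 0%N isT)] => /= ->.
  by move=> /eqP; rewrite (negbTE ab).
Qed.

End frequencies.

(** A cylinder of positive mass is visited infinitely often, as its mass is a limit
of frequencies of visits. *)
Lemma krylov_bogolyubov x : exists rho : probability X R, shift_invariant rho /\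
  forall y n, 0 < mass rho y n ->
    forall N, exists2 j, (N <= j)%N & agree n (iter j sshift x) y.
Proof.
have [G [GU Goo]] := ultraFilterLemma eventually_filter.
exact: ultra_krylov_bogolyubov GU Goo.
Qed.

(** The points around which some cylinder is null are covered by countably many null
cylinders. *)
Lemma mean_eq0 (rho : probability X R) u : continuous u ->
  (forall y, (forall n, 0 < mass rho y n) -> u y = 0) -> mean rho u = 0.
Proof.
move=> cu u0; rewrite /mean /Rintegral -[RHS]/(fine 0%E); congr fine.
pose F k : set X := if (unpickle k : option (seq 'I_d.+1)) is Some w then
  if rho (cyl w) == 0%E then cyl w else set0 else set0.
pose N := \bigcup_k F k.
have mN : rho.-negligible N.
  apply: negligible_bigcup => k; rewrite /F.
  case: (unpickle k) => [w|]; last exact: negligible_set0.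
  case: eqP => [w0|_]; last exact: negligible_set0.
  by exists (cyl w); split => //; rewrite cylE; exact: measurable_cylinder.
have uN : ae_eq rho setT (EFin \o u) (cst 0%E).
  apply: negligibleS mN => y /= /not_implyP[_ uy].
  have [n n0] : exists n, ~ 0 < mass rho y n.
    by apply/existsNP => y0; apply: uy; rewrite /= u0.
  exists (pickle (mkseq y n)) => //=; rewrite /F pickleK cyl_mkseq massE.
  rewrite ifT; first exact: cylinder_refl.
  by rewrite eqe eq_le mass_ge0 andbT leNgt; apply/negP.
rewrite (ae_eq_integral (cst 0%E)) ?integral_cst ?mul0e //.
by apply/measurable_EFinP; exact: measurable_continuous.
Qed.

Lemma exists_charged_point (rho : probability X R) :
  exists y, forall n, 0 < mass rho y n.
Proof.
have [|||y _ y0] := @exists_branch R theta theta01 d (fun y n => 0 < mass rho y n) point 0.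
- move=> y m; rewrite mass_splitS => y0; apply: contrapT => ny; move: y0.
  rewrite big1 ?ltxx // => a _; apply/eqP; rewrite eq_le mass_ge0 andbT leNgt.
  by apply/negP => ay; apply: ny; exists a.
- by move=> y z m /(eq_mass rho) ->.
- by rewrite mass0.
by exists y => n; exact: y0.
Qed.

Lemma charged_msupp (rho : probability X R) y :
  (forall n, 0 < mass rho y n) -> msupp rho y.
Proof.
move=> y0 V oV Vy; have /nbhs_cylinderP[n nV] : nbhs y V by exact: open_nbhs_nbhs.
apply: (@lt_le_trans _ _ (rho (cylinder y n))); first by rewrite massE lte_fin.
apply: le_measure => //; rewrite inE; first exact: measurable_cylinder.
exact: open_measurable_fullshift.
Qed.

Lemma recurrent_orbit_acc x y :
  (forall n N, exists2 j, (N <= j)%N & agree n (iter j sshift x) y) ->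
  orbit_acc x y.
Proof.
move=> rec.
have /choice[J JP] (nN : nat * nat) : exists j, (nN.2 <= j)%N /\
    agree nN.1 (iter j sshift x) y.
  by have [j h1 h2] := rec nN.1 nN.2; exists j.
pose s := fix s i := if i is i'.+1 then J (i, (s i').+1) else J (0%N, 1%N).
have sag i : agree i (iter (s i) sshift x) y.
  by case: i => [|i]; [have [] := JP (0%N, 1%N)|have [] := JP (i.+1, (s i).+1)].
exists s; split.
- by have [] := JP (0%N, 1%N).
- apply: homo_ltn; first exact: ltn_trans.
  by move=> i; have [] := JP (i.+1, (s i).+1).
- apply/cvg_agreeP => n; exists n => // i /= ni.
  exact: agree_leq ni (sag i).
Qed.

Lemma orbit_acc_agree x y : orbit_acc x y ->
  forall n N, exists2 j, (N <= j)%N & agree n (iter j sshift x) y.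
Proof.
move=> [s [_ smono /cvg_agreeP sy]] n N; have [M _ My] := sy n.
exists (s (maxn M N)); last by apply: My => /=; exact: leq_maxl.
apply: leq_trans (leq_maxr M N) _.
elim: (maxn M N) => // k IH; apply: leq_ltn_trans IH _; exact: smono.
Qed.

End krylov_bogolyubov.

(** * The deviation function along orbits *)

Section aubry.
Context {R : realType} {theta : R} {theta01 : 0 < theta < 1} {d : nat}.
Local Notation X := (fullshift theta01 d).
Implicit Types (x y z : X) (n m j : nat) (u v : X -> R).
Variables (f V r : X -> R) (J : X -> nat -> R) (p C : R).
Hypothesis cf : continuous f.
Hypothesis cV : continuous V.
Hypothesis rC : vary C r.
Hypothesis r_ge0 : forall x, 0 <= r x.
Hypothesis rE : forall x, r x = p - f x - V x + V (sshift x).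
Hypothesis Jagree : forall x y n, agree n x y -> J x n = J y n.
Hypothesis Jnd : forall x, nondecreasing_seq (J x).
Hypothesis J0 : forall x, J x 0 = 0.

Local Notation I := (fun x => esup_seq (J x)).
Hypothesis IE : forall x, I x = ((r x)%:E + I (sshift x))%E.

Let th0 : 0 < theta := theta_gt0 (theta01 := theta01).
Let th1 : theta < 1 := theta_lt1 (theta01 := theta01).
Local Notation Q := (C / (1 - theta)).

Let I_ge0 x : (0 <= I x)%E.
Proof. by have := esup_seq_ub (J x) 0; rewrite J0. Qed.

Lemma deviation_birkhoff n x : I x = ((birkhoff r n x)%:E + I (iter n sshift x))%E.
Proof.
elim: n x => [|n IH] x; first by rewrite /birkhoff big_nil add0e.
by rewrite iterSr birkhoffS EFinD -addeA -IH.
Qed.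

Lemma birkhoff_nondecreasing x : nondecreasing_seq (fun n => birkhoff r n x).
Proof.
move=> m n mn; rewrite /birkhoff (big_cat_nat (leq0n m) mn) /= lerDl.
exact: sumr_ge0.
Qed.

Lemma birkhoff_limE x : birkhoff_lim r x = esup_seq (fun n => birkhoff r n x).
Proof.
by apply: cvg_lim => //; apply: cvg_esup_seq; exact: birkhoff_nondecreasing.
Qed.

Lemma birkhoff_lim_le x : (birkhoff_lim r x <= I x)%E.
Proof.
rewrite birkhoff_limE; apply: esup_seq_le => n.
by rewrite (deviation_birkhoff n) leeDl.
Qed.

(** By invariance the coboundary [V o sigma - V] has mean zero. *)
Lemma mean_potential (rho : probability X R) : shift_invariant rho ->
  mean rho f = p - mean rho r.
Proof.
move=> inv; have cr := vary_continuous rC.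
have cVs := continuous_sshift cV.
have -> : mean rho f = mean rho (fun x => (p - r x) + (V (sshift x) - V x)).
  by apply: eq_mean => x; rewrite rE; lra.
have cpr : continuous (fun x => p - r x).
  exact: (vary_continuous (vary_add (vary_cst p) (vary_opp rC))).
rewrite meanD //; last exact: continuous_sub.
rewrite !meanB //; last exact: continuous_cst.
by rewrite mean_cst (mean_sshift inv cV) subrr addr0.
Qed.

Lemma maximizing_of_mean0 (rho : probability X R) : shift_invariant rho ->
  mean rho r = 0 -> maximizing f rho.
Proof.
move=> inv r0; split=> //; have fp := mean_potential inv; rewrite r0 subr0 in fp.
rewrite meanE // fp; apply/eqP; rewrite eq_le; apply/andP; split.
  by rewrite -fp -meanE //; apply: ereal_sup_ubound; exists rho.
apply: ge_ereal_sup => _ [rho' inv' <-]; rewrite meanE // lee_fin.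
rewrite (mean_potential inv') gerBl -(mean_cst rho' 0); apply: le_mean => //.
  exact: continuous_cst.
exact: vary_continuous rC.
Qed.

Lemma cvg_orbit_potential x : (birkhoff_lim r x < +oo)%E ->
  r (iter n sshift x) @[n --> \oo] --> 0.
Proof.
rewrite birkhoff_limE => fin.
apply: cvg_series_cvg_0; apply: nondecreasing_is_cvgn.
  exact: birkhoff_nondecreasing.
have ge : (0 <= esup_seq (fun n => birkhoff r n x))%E.
  by have := esup_seq_ub (fun n => birkhoff r n x) 0; rewrite {1}/birkhoff big_nil.
exists (fine (esup_seq (fun n => birkhoff r n x))) => _ [n _ <-].
rewrite -lee_fin fineK; last by rewrite ge0_fin_numE.
exact: (esup_seq_ub (fun n => birkhoff r n x)).
Qed.

(** An invariant measure carried by the limit set of the orbit integrates [r] to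
zero, hence is maximizing. *)
Lemma exists_maximizing_acc x : (birkhoff_lim r x < +oo)%E ->
  exists2 y, Xmax f y & orbit_acc x y.
Proof.
move=> /cvg_orbit_potential r0.
have [rho [inv rec]] := krylov_bogolyubov x.
have zero y : (forall n, 0 < mass rho y n) -> r y = 0.
  move=> y0; apply/eqP; rewrite -normr_le0; apply/ler_addgt0Pr => e e0.
  have [n ne] := exists_exp_lt (theta01 := theta01) C (divr_gt0 e0 (ltr0n _ 2)).
  have /cvgrPdist_lt/(_ _ (divr_gt0 e0 (ltr0n _ 2)))[N _ NP] := r0.
  have [j Nj jy] := rec y n (y0 n) N.
  have := NP j Nj; have := rC jy; rewrite /= sub0r normrN.
  rewrite !ler_norml !ltr_norml => /andP[? ?] /andP[? ?].
  by apply/andP; split; lra.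
have [y y0] := exists_charged_point rho.
exists y; last by apply: recurrent_orbit_acc => n; exact: rec.
exists rho; last exact: charged_msupp.
apply: maximizing_of_mean0 => //; apply: mean_eq0 zero; exact: vary_continuous rC.
Qed.

(** After [i] of the [j] steps the two orbits agree on [j - i + m] letters: the
errors form a geometric series. *)
Lemma birkhoff_concat x y j m : agree m (iter j sshift x) y ->
  `|birkhoff r j (concat x j y) - birkhoff r j x| <= Q * theta ^+ m.
Proof.
have Q0 : 0 <= Q by rewrite divr_ge0 ?(vary_ge0 rC) // subr_ge0 ltW.
move=> xy; suff : `|birkhoff r j (concat x j y) - birkhoff r j x| <=
    Q * (1 - theta ^+ j) * theta ^+ m.
  move=> /le_trans; apply; apply: ler_wpM2r; first exact/exprn_ge0/ltW.
  by rewrite ler_piMr // gerBl exprn_ge0 // ltW.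
elim: j x xy => [|j IH] x xy.
  by rewrite /birkhoff !big_nil subrr normr0 expr0 subrr mulr0 mul0r.
rewrite !birkhoffS sshift_concatS opprD addrACA.
apply: le_trans (ler_normD _ _) _.
have -> : Q * (1 - theta ^+ j.+1) * theta ^+ m =
    C * theta ^+ j * theta ^+ m + Q * (1 - theta ^+ j) * theta ^+ m.
  by rewrite exprS; field; rewrite subr_eq0 eq_sym lt_eqF.
apply: lerD; last by apply: IH; rewrite -iterSr.
have := agree_iter_concat (leq0n j.+1) xy; rewrite subn0 => /rC /le_trans; apply.
rewrite -mulrA -exprD ler_wpM2l ?(vary_ge0 rC) //.
by apply: ler_wiXn2l; rewrite ?ltW // leq_add2r.
Qed.

(** The lower bound is the lower semicontinuity of [I] at [y] along the orbit of
[x]; the upper bound is its lower semicontinuity at [x] along the points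
[x_1 ... x_j y], where [birkhoff_concat] applies. *)
Lemma deviation_acc x y : (birkhoff_lim r x < +oo)%E -> orbit_acc x y ->
  I x = (birkhoff_lim r x + I y)%E.
Proof.
move=> fin /orbit_acc_agree acc; rewrite birkhoff_limE.
apply/eqP; rewrite eq_le; apply/andP; split; last first.
  apply: le_trans (esup_seqD _ _ _ _) _ => //.
  - exact: birkhoff_nondecreasing.
  - by rewrite /birkhoff big_nil.
  - by rewrite J0.
  apply: esup_seq_le => n; have [j nj jy] := acc n n.
  rewrite (deviation_birkhoff j x) EFinD; apply: leeD.
    by rewrite lee_fin; exact: birkhoff_nondecreasing.
  by rewrite -(Jagree jy); exact: esup_seq_ub.
apply: esup_seq_le => n; apply/lee_addgt0Pr => e e0.
have [m me] := exists_exp_lt (theta01 := theta01) Q e0.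
have [j nj jy] := acc m n.
(* The rate at level n does not see that the letters after j are changed. *)
have xz := agree_leq nj (agree_sym (agree_concat j x y)).
rewrite (Jagree xz); apply: le_trans (esup_seq_ub _ n) _.
have := deviation_birkhoff j (concat x j y); rewrite iter_concat => ->.
rewrite addeAC; apply: leeD2r.
apply: (@le_trans _ _ (birkhoff r j x + e)%:E).
  have := birkhoff_concat jy; rewrite lee_fin ler_norml => /andP[_ ?]; lra.
rewrite EFinD; apply: leeD2r; exact: (esup_seq_ub (fun n => birkhoff r n x)).
Qed.

(** By [deviation_birkhoff] the terms on the right are the values of [I] at the
points [x_1 ... x_n y], which tend to [x]: one inequality is lower
semicontinuity. For the other, take [y] as in [exists_maximizing_acc]. *)
Lemma deviation_formula x : I x = ereal_inf
  [set limn_einf (fun n => ((birkhoff r n (concat x n y))%:E + I y)%E) | y in Xmax f].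
Proof.
have IcE y n : ((birkhoff r n (concat x n y))%:E + I y)%E = I (concat x n y).
  by rewrite (deviation_birkhoff n (concat x n y)) iter_concat.
have einfE y : limn_einf (fun n => ((birkhoff r n (concat x n y))%:E + I y)%E) =
    ereal_sup (range (einfs (fun n => I (concat x n y)))).
  under [X in limn_einf X]eq_fun do rewrite IcE.
  rewrite limn_einf_lim; apply: cvg_lim => //; exact: cvg_einfs_sup.
apply/eqP; rewrite eq_le; apply/andP; split.
  apply: le_ereal_inf_tmp => _ [y _ <-]; rewrite einfE.
  apply: esup_seq_le => n.
  apply: (@le_trans _ _ (einfs (fun n => I (concat x n y)) n)); last first.
    by apply: ereal_sup_ubound; exists n.
  apply: le_ereal_inf_tmp => _ [k /= nk <-].
  by rewrite -(Jagree (agree_leq nk (agree_concat k x y))); exact: esup_seq_ub.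
have [->|Ifin] := eqVneq (I x) +oo%E; first exact: leey.
have fin : (birkhoff_lim r x < +oo)%E.
  by apply: le_lt_trans (birkhoff_lim_le x) _; rewrite ltey.
have [y yX xy] := exists_maximizing_acc fin.
apply: (@le_trans _ _ (ereal_sup (range (einfs (fun n => I (concat x n y)))))).
  by rewrite -einfE; apply: ereal_inf_lbound; exists y.
apply: ge_ereal_sup => _ [n _ <-]; apply/lee_addgt0Pr => e e0.
have [m me] := exists_exp_lt (theta01 := theta01) Q e0.
have [j nj jy] := orbit_acc_agree xy m n.
apply: (@le_trans _ _ (I (concat x j y))).
  by apply: ereal_inf_lbound; exists j.
rewrite (deviation_acc fin xy) -IcE addeAC; apply: leeD2r.
apply: (@le_trans _ _ (birkhoff r j x + e)%:E).
  have := birkhoff_concat jy; rewrite lee_fin ler_norml => /andP[_ ?]; lra.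
rewrite EFinD; apply: leeD2r; rewrite birkhoff_limE.
exact: (esup_seq_ub (fun n => birkhoff r n x)).
Qed.

End aubry.

Unset Implicit Arguments.

Theorem theorem1 (R : realType) (theta : R) (theta01 : 0 < theta < 1) (d : nat)
  (f : fullshift theta01 d -> R)
  (mu nu : R -> probability (fullshift theta01 d) R)
  (h : R -> fullshift theta01 d -> R)
  (f_lip : lipschitz_fun f)
  (mu_eq : forall b : R, 0 < b -> equilibrium (fun x => b * f x) (mu b))
  (nu_eigen : forall b : R, 0 < b -> eigenmeasure (fun x => b * f x) (nu b))
  (h_eigen : forall b : R, 0 < b -> eigenfunction (fun x => b * f x) (nu b) (h b))
  (mu_lim : forall k, is_cylinder k -> cvg (log_rate mu k b @[b --> +oo%R])) :
  let g b := normalized_potential (fun x => b * f x) (h b) in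
  let I := deviation mu in
  [/\ (forall x, cvgn (fun n => lim (log_rate mu (cylinder x n) b @[b --> +oo%R]))),
      ldp mu I,
      exists Rp : fullshift theta01 d -> R,
        [/\ {uniform, (fun x => - (g b x / b)) @[b --> +oo%R] --> Rp},
            (forall x, 0 <= Rp x),
            (forall x, I x = ((Rp x)%:E + I (sshift x))%E),
            (forall x, (birkhoff_lim Rp x <= I x)%E) &
            forall x,
              I x = ereal_inf
                [set limn_einf (fun n => ((birkhoff Rp n (concat x n y))%:E + I y)%E)
                | y in Xmax f] /\
              ((birkhoff_lim Rp x < +oo)%E ->
                (exists2 y, Xmax f y & orbit_acc x y) /\
                forall y, Xmax f y -> orbit_acc x y ->
                  I x = (birkhoff_lim Rp x + I y)%E)] &
      exists V : fullshift theta01 d -> R,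
        {uniform, (fun x => ln (h b x) / b) @[b --> +oo%R] --> V} /\
        ldp nu (fun x => (I x + (V x)%:E)%E)].
Proof.
have [L fL] := lipschitz_vary f_lip; move=> g I.
pose J := mu_rate fL mu_eq nu_eigen h_eigen mu_lim.
pose r := subaction fL mu_eq nu_eigen h_eigen mu_lim.
have IE : I = fun x => esup_seq (J x) by exact: deviationE.
have mu0 (b : R) x n : 0 < b -> 0 < mass (mu b) x n.
  exact: (mass_equilibrium_gt0 fL mu_eq nu_eigen h_eigen).
have JP : forall x n, rate mu x n b @[b --> +oo] --> (J x n : R).
  by move=> x n; exact: mu_rateP.
have Jag x y n : agree n x y -> J x n = J y n by exact: (rate_lim_agree JP).
have Jnd x : nondecreasing_seq (J x) by exact: mu_rate_nondecreasing.
have J0 x : J x 0 = 0 by exact: (rate_lim0 JP).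
have rC : vary _ r := vary_subaction fL mu_eq nu_eigen h_eigen mu_lim.
have r_ge0 x : 0 <= r x by exact: subaction_ge0.
have rI x : I x = ((r x)%:E + I (sshift x))%E.
  by rewrite IE; exact: mu_deviationE.
have [V [Vcvg VK rV Vldp]] :=
  scaled_eigenfunction_limit fL mu_eq nu_eigen h_eigen mu_lim.
have cf := vary_continuous fL; have cV := vary_continuous VK.
rewrite IE in rI; rewrite IE; split.
- by move=> x; 
  exact: (cvgP _ (@cvg_lim_log_rate _ _ _ _ _ _ _ _ _ fL mu_eq nu_eigen h_eigen mu_lim x)).
- exact: ldp_rates.
- exists r; split => //.
  + exact: scaled_potential_uniform.
  + by move=> x; exact: (birkhoff_lim_le r_ge0 J0 rI x).
  + move=> x; split; first exact: (deviation_formula cf cV rC r_ge0 rV Jag Jnd J0 rI).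
    move=> fin; split; first exact: (exists_maximizing_acc cf cV rC r_ge0 rV fin).
    by move=> y _; exact: (deviation_acc rC r_ge0 Jag Jnd J0 rI fin).
- exists V; split; last exact: Vldp.
  exact: (scaled_eigenfunction_uniform fL h_eigen Vcvg).
Qed.
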